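(* Let $\langle\mathcal{A}\,\|\,\mathcal{R}\rangle$ be a finite group presentation (i.e. both $\mathcal{A}$ and $\mathcal{R}$ are finite). Then all of its Dehn functions $f_0(x)$, $f_1(x)$, $f_2(x)$ are equivalent, i.e. $f_0\simeq f_1\simeq f_2$.
   Context: Presentations. $\mathcal{A}=\{a_1,\dots,a_m\}$ is a finite alphabet, $\mathcal{A}^{\pm1}=\mathcal{A}\cup\mathcal{A}^{-1}$, $F(\mathcal{A})$ is the free group over $\mathcal{A}$, and $|W|$ is the length of a word $W$ over $\mathcal{A}^{\pm1}$. The relator set $\mathcal{R}$ consists of nonempty cyclically reduced words over $\mathcal{A}^{\pm1}$; $\langle\langle\mathcal{R}\rangle\rangle$ is its normal closure in $F(\mathcal{A})$, and $\langle\mathcal{A}\,\|\,\mathcal{R}\rangle$ presents the group $F(\mathcal{A})/\langle\langle\mathcal{R}\rangle\rangle$. A word $W$ over $\mathcal{A}^{\pm1}$ is said to be in $\langle\langle\mathcal{R}\rangle\rangle$ if the element of $F(\mathcal{A})$ it represents is. Van Kampen diagrams. $K(\mathcal{A},\mathcal{R})$ is the standard presentation 2-complex: one 0-cell, oriented 1-cells in bijection with the letters of $\mathcal{A}^{\pm1}$ (a letter and its inverse corresponding to opposite orientations of one 1-cell), 2-cells in bijection with the words of $\mathcal{R}$, attached along these words. A van Kampen diagram over $\langle\mathcal{A}\,\|\,\mathcal{R}\rangle$ is a planar, finite, connected and simply connected 2-complex $\Delta$ with a continuous cellular map to $K(\mathcal{A},\mathcal{R})$ whose restriction to every (open) cell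 is a homeomorphism onto a cell. Thus each oriented edge $e$ carries a label $\varphi(e)\in\mathcal{A}^{\pm1}$ with $\varphi(e^{-1})=\varphi(e)^{-1}$, and the boundary of each 2-cell is labeled by a cyclic permutation of a word of $\mathcal{R}$ or its inverse. The label $\varphi(p)$ of a path $p=e_1\cdots e_k$ is $\varphi(e_1)\cdots\varphi(e_k)$. $\partial\Delta$ is the boundary path of $\Delta$, $\varphi(\partial\Delta)\equiv W$ means literal equality as cyclic words, and $|\Delta(j)|$ is the number of $j$-cells of $\Delta$. By van Kampen's lemma, $W\in\langle\langle\mathcal{R}\rangle\rangle$ if and only if there is a van Kampen diagram $\Delta$ with $\varphi(\partial\Delta)\equiv W$. Dehn $j$-functions. For $W\in\langle\langle\mathcal{R}\rangle\rangle$ and $j\in\{0,1,2\}$ let $L_j(W)=\min\{|\Delta(j)| : \varphi(\partial\Delta)\equiv W\}$, the minimum over van Kampen diagrams $\Delta$ over the presentation. The Dehn $j$-function is, for integers $x\ge1$, $f_j(x)=\max\{L_j(W) : W\in\langle\langle\mathcal{R}\rangle\rangle,\ |W|\le x\}$. Comparison of functions. For functions $f,g:\mathbb{N}\to\mathbb{N}\cup\{0\}$, where $\mathbb{N}=\{1,2,\dots\}$, write $f\preccurlyeq g$ if there is an integer $C>0$ such that $f(x)\le C\,g(Cx)+Cx$ for every $x\in\mathbb{N}$. Write $f\simeq g$ if $f\preccurlyeq g$ and $g\preccurlyeq f$. *)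

(* Defs.v *)
From Stdlib Require Import Relation_Operators.
From mathcomp Require Import all_boot.
From mathcomp Require Import boolp classical_sets.

Set Implicit Arguments.
Unset Strict Implicit.
Unset Printing Implicit Defensive.

(* (a, false) stands for the letter a, (a, true) for its inverse. *)
Notation letter A := (Finite.sort A * bool)%type.

Definition linv (A : finType) (x : letter A) : letter A := (x.1, ~~ x.2).

Notation word A := (seq (letter A)).

Definition winv (A : finType) (w : word A) : word A := rev (map (@linv A) w).

(* path.cycle also compares the last letter with the first one. *)
Definition cyclically_reduced (A : finType) (w : word A) : bool :=
  cycle (fun x y : letter A => y != linv x) w.

(* The list R stands for the finite set of its members. *)
Definition finite_presentation (A : finType) (R : seq (word A)) : Prop :=
  forall r : word A, r \in R -> r <> [::] /\ cyclically_reduced r.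

Inductive free_insertion (A : finType) : word A -> word A -> Prop :=
  FreeInsertion (u v : word A) (x : letter A) :
    free_insertion (u ++ v) (u ++ [:: x; linv x] ++ v).

(* u and v represent the same element of the free group F(A). *)
Definition free_eq (A : finType) : word A -> word A -> Prop :=
  clos_refl_sym_trans (word A) (@free_insertion A).

(* The least normal subgroup of F(A) containing R, as a predicate on the words
   representing its elements. *)
Inductive normal_closure (A : finType) (R : seq (word A)) : word A -> Prop :=
| NclRelator r : r \in R -> normal_closure R r
| NclOne : normal_closure R [::]
| NclMul u v :
    normal_closure R u -> normal_closure R v -> normal_closure R (u ++ v)
| NclInv u : normal_closure R u -> normal_closure R (winv u)
| NclConj g u : normal_closure R u -> normal_closure R (winv g ++ u ++ g)
| NclFree u v : free_eq u v -> normal_closure R u -> normal_closure R v.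

Definition cyclic_eq (T : Type) (u v : seq T) : Prop :=
  exists i : nat, u = rot i v.

(* A finite connected graph drawn on the sphere, encoded as a combinatorial map
   on its oriented edges:
   - einv e is e with the opposite orientation;
   - next e follows e on the boundary of the region lying to the left of e, so
     that the regions are the orbits of next;
   - turn e is the oriented edge following e around the origin of e, so that the
     vertices are the orbits of turn.
   A map without edges is a single vertex in a single region; it has no orbits,
   whence the correction terms (#|dart| == 0). *)
Record combinatorial_map := CombinatorialMap {
  dart : finType;
  einv : dart -> dart;
  next : dart -> dart;
  einvK : involutive einv;
  einv_neq : forall e, einv e != e;
  next_inj : injective next
}.

Section Maps.
Variable G : combinatorial_map.

Definition turn (e : dart G) : dart G := next (einv e).

Definition vertex_count : nat := fcard turn (dart G) + (#|dart G| == 0).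
Definition edge_count : nat := #|dart G|./2.
Definition region_count : nat := fcard (@next G) (dart G) + (#|dart G| == 0).

Definition map_connected : Prop :=
  forall d e : dart G,
    connect [rel x y | (y == einv x) || (y == next x)] d e.

(* Genus 0, for connected maps. *)
Definition spherical : Prop :=
  vertex_count + region_count = edge_count + 2.

Definition follows (d e : dart G) : bool := fconnect turn (einv d) e.

Definition closed_path (p : seq (dart G)) : bool := cycle follows p.

(* Elementary homotopies of closed edge paths in the 2-complex whose 2-cells are
   the regions contained in c; [::] is the constant path. *)
Definition homotopy_step (c : {set dart G}) (p q : seq (dart G)) : Prop :=
  [/\ closed_path p, closed_path q &
      exists u s v : seq (dart G),
        [/\ p = u ++ s ++ v, q = u ++ v &
            (exists d, s = [:: d; einv d]) \/
            (exists2 d, d \in c & s = orbit (@next G) d)]].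

Definition simply_connected (c : {set dart G}) : Prop :=
  forall p, closed_path p ->
    clos_refl_sym_trans (seq (dart G)) (homotopy_step c) p [::].

End Maps.

(* A planar complex is a spherical map together with a set of regions, its
   2-cells, which does not contain the unbounded region. [twocell] is the set of
   the oriented edges having a 2-cell on their left; [bnd] is the boundary cycle
   of the unbounded region. As this region also lies to the left of [bnd], the
   complex itself lies to its right: the boundary path of the diagram is read
   clockwise, those of its 2-cells counterclockwise. *)
Record diagram (A : finType) (R : seq (word A)) := Diagram {
  skeleton :> combinatorial_map;
  twocell : {set dart skeleton};
  bnd : seq (dart skeleton);
  lab : dart skeleton -> letter A;
  skeleton_connected : map_connected skeleton;
  skeleton_spherical : spherical skeleton;
  twocell_closed : fclosed (@next skeleton) twocell;
  bnd_cycle : ufcycle (@next skeleton) bnd;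
  bnd_nil : bnd = [::] -> #|dart skeleton| = 0;
  bnd_outer : forall e, e \in bnd -> e \notin twocell;
  diagram_simply_connected : simply_connected twocell;
  lab_einv : forall e, lab (einv e) = linv (lab e);
  lab_twocell : forall e, e \in twocell ->
    exists2 r : word A, r \in R &
      cyclic_eq (map lab (orbit (@next skeleton) e)) r \/
      cyclic_eq (map lab (orbit (@next skeleton) e)) (winv r)
}.

Definition boundary_label (A : finType) (R : seq (word A)) (D : diagram R) :
  word A := map (@lab A R D) (bnd D).

(* The number |D(j)| of j-cells of D. *)
Definition cell_count (A : finType) (R : seq (word A)) (j : nat)
    (D : diagram R) : nat :=
  match j with
  | 0 => vertex_count D
  | 1 => edge_count D
  | 2 => fcard (@next D) (twocell D)
  | _ => 0
  end.

Definition is_min_cells (A : finType) (R : seq (word A)) (j : nat) (W : word A)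
    (n : nat) : Prop :=
  (exists D : diagram R,
      cyclic_eq (boundary_label D) W /\ cell_count j D = n) /\
  (forall D : diagram R,
      cyclic_eq (boundary_label D) W -> n <= cell_count j D).

(* The default value 0 of xget only concerns words bounding no diagram, i.e.
   words outside the normal closure. *)
Definition min_cells (A : finType) (R : seq (word A)) (j : nat) (W : word A) :
  nat := xget 0 [set n | is_min_cells R j W n]%classic.

Definition dehn (A : finType) (R : seq (word A)) (j : nat) (x : nat) : nat :=
  \max_(n < x.+1)
    \max_(W : n.-tuple (letter A) | `[< normal_closure R W >])
      min_cells R j W.

Definition fpreceq (f g : nat -> nat) : Prop :=
  exists C : nat, 0 < C /\ forall x : nat, 0 < x -> f x <= C * g (C * x) + C * x.

Definition fequiv (f g : nat -> nat) : Prop := fpreceq f g /\ fpreceq g f.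

(* Main.v *)
From Stdlib Require Import Relation_Operators.
From mathcomp Require Import fingroup perm boolp classical_sets all_boot zify.
Require Import Defs.

Set Implicit Arguments.
Unset Strict Implicit.
Unset Printing Implicit Defensive.

(* A diagram D is a plane map, i.e. a pair of permutations (opposite edge, next
   edge of the region) of genus 0.  Simple connectivity of D forces its only
   region which is not a 2-cell to be the outer one, so Euler's formula reads
   V + F = E + 1 and, with M the length of the longest relator,
   2 E <= M F + |W|; this gives every comparison but the bounds on E and F in
   terms of V.  For these, erase an edge of D whenever it separates a region
   with at most two sides from another inner region.  No region gets longer
   than M, and when the process stops the small regions border the outer one:
   there are at most |W| of them, and Euler's formula bounds the number of
   regions by 3 (V + |W|).  As finitely many words have length at most M, each
   region has area at most a constant K.  Hence W is a product of at most
   3 K (V + |W|) conjugates of relators, and a second diagram with so many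
   2-cells is built by cutting and folding the boundary of a plane tree. *)

(** * Transpositions and the genus inequality *)

(** Vertices are the obstacle. Relators of length two let bigons be stacked between the same two
    vertices, so the vertices and the boundary of a diagram need not bound its edges or 2-cells, and
    another diagram with the same boundary has to be found. The map left after erasing edges is not
    that diagram, since the labels of its regions need not be relators any more; it only serves to
    bound the area of the boundary word. The threshold of two sides is the one at which erasing is
    harmless: merging such a region with one of at most [M] sides gives at most [M] sides again.
    Every surgery multiplies one permutation by transpositions. Planarity is the equality case of an
    inequality valid for all pairs of permutations, so checking a surgery amounts to counting cycles
    and components; components are counted because surgeries may disconnect the map. Simple
    connectivity is given by homotopies of paths, hence needs an argument in both directions:
    intersection numbers modulo 2 to exploit it, pushing paths across regions until a tree remains
    to establish it. *)

Section Components.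
Variable T : finType.
Implicit Types (e : rel T) (s t : {perm T}).

Definition link e x y : rel T :=
  relU e [rel u v | (u == x) && (v == y) || (u == y) && (v == x)].

Lemma connect_link e x y : subrel (connect e) (connect (link e x y)).
Proof. by apply: connect_sub => u v euv; apply: connect1; apply/orP; left. Qed.

Lemma linkxy e x y : connect (link e x y) x y.
Proof. by apply: connect1; rewrite /link /= !eqxx orbT. Qed.

Lemma link_sym e x y : connect_sym e -> connect_sym (link e x y).
Proof.
move=> se; apply: relU_sym => //; apply: sym_connect_sym => u v /=.
by rewrite orbC andbC [(v == y) && _]andbC.
Qed.

Lemma link_subl e e' x y : connect_sym e' -> subrel e (connect e') ->
  connect e' x y -> subrel (connect (link e x y)) (connect e').
Proof.
move=> se' ee' xy; apply: connect_sub => u v /orP[/ee' //|].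
by case/orP => /andP[/eqP-> /eqP->]; rewrite // se'.
Qed.

Lemma n_comp_link e x y : connect_sym e ->
  n_comp e T = n_comp (link e x y) T + ~~ connect e x y.
Proof.
move=> se; have sl := link_sym x y se.
case: (boolP (connect e x y)) => [xy|nxy].
  rewrite addn0; apply: eq_n_comp => u v; apply/idP/idP.
    exact: connect_link.
  by apply: link_subl => // ? ?; apply: connect1.
(* [a] is the union of the components of [x] and [y]: the link turns these two into one and leaves
   those outside [a] alone. *)
pose a := closure e (pred2 x y).
have cla : closed e a by apply: closure_closed.
have ax : x \in a by apply: mem_closure; rewrite !inE eqxx.
have ay : y \in a by apply: mem_closure; rewrite !inE eqxx orbT.
have cla' : closed (link e x y) a.
  move=> u v /orP[/cla //|]; case/orP => /andP[/eqP-> /eqP->];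
  by rewrite ax ay.
rewrite (n_compC a) (n_compC a (link e x y)).
have -> : n_comp e a = 2 by rewrite n_comp_closure2 // nxy.
have -> : n_comp (link e x y) a = 1.
  rewrite -(n_comp_connect sl x); apply: eq_n_comp_r => z.
  apply/idP/idP => [|xz]; last by rewrite -(closed_connect cla' xz).
  case/existsP => w /andP[/= zw].
  rewrite !inE => wxy; have zw' := connect_link x y zw.
  change (connect (link e x y) x z).
  rewrite sl; apply: (connect_trans zw').
  by case/orP: wxy => /eqP->; rewrite ?connect0 // sl linkxy.
have -> : n_comp e [predC a] = n_comp (link e x y) [predC a].
  apply: eq_card => z; rewrite !inE; case: (boolP (z \in a)) => /= [|nza].
    by rewrite !andbF.
  rewrite !andbT /roots /root; congr (odflt z _ == z); apply: eq_pick => u.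
  apply/idP/idP; first exact: connect_link.
  have clz : closed (link e x y) (connect e z).
    move=> v w /orP[/(connect_closed se z) //|].
    have nx : connect e z x = false.
      by apply/negbTE/negP => zx; case/negP: nza; rewrite (closed_connect cla zx).
    have ny : connect e z y = false.
      by apply/negbTE/negP => zx; case/negP: nza; rewrite (closed_connect cla zx).
    by case/orP => /andP[/eqP-> /eqP->]; rewrite !inE /= nx ny.
  by move/(closed_connect clz); rewrite !inE connect0 => <-.
lia.
Qed.

(* Both sides count the components of the common linked relation. *)
Lemma n_comp_swap e e' x y : connect_sym e -> connect_sym e' ->
    subrel e (connect (link e' x y)) -> subrel e' (connect (link e x y)) ->
  n_comp e T + ~~ connect e' x y = n_comp e' T + ~~ connect e x y.
Proof.
move=> se se' ee' e'e; rewrite (n_comp_link x y se) (n_comp_link x y se').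
suff -> : n_comp (link e x y) T = n_comp (link e' x y) T by lia.
apply: eq_n_comp => u v; apply/idP/idP; apply: link_subl => //;
  by [apply: link_sym | apply: linkxy].
Qed.

Definition ncycle s := fcard s T.

Lemma pfrel_sym s : connect_sym (frel s).
Proof. by apply: fconnect_sym; apply: perm_inj. Qed.

Lemma porbit_fconnect s x y : (y \in porbit s x) = fconnect s x y.
Proof.
apply/porbitP/idP => [[i ->]|]; first by rewrite permX fconnect_iter.
by move=> /iter_findex <-; exists (findex s x y); rewrite permX.
Qed.

Lemma porbits_ncycle s : #|porbits s| = ncycle s.
Proof.
rewrite /ncycle /n_comp_mem -(card_in_imset (f := porbit s)).
  apply: eq_card => A; apply/imsetP/imsetP => -[x _ ->].
    exists (froot s x); first by rewrite !inE (roots_root (pfrel_sym s)).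
    by apply/esym/eqP; rewrite eq_porbit_mem porbit_fconnect connect_root.
  by exists x.
move=> x y; rewrite !inE !andbT => /eqP rx /eqP ry /eqP.
rewrite eq_porbit_mem porbit_sym porbit_fconnect => /(rootP (pfrel_sym s)).
by rewrite rx ry.
Qed.

Lemma ncycle_tperm s x y :
  ncycle (tperm x y * s)%g + (~~ fconnect s x y).*2 = ncycle s + (x != y).
Proof.
by rewrite -!porbits_ncycle -porbits_mul_tperm porbit_sym porbit_fconnect.
Qed.

Lemma ncycle_tperm_le s x y : ncycle (tperm x y * s)%g <= (ncycle s).+1.
Proof. by have := ncycle_tperm s x y; case: (x != y) => /=; lia. Qed.

Lemma ncycle_tperm_split s x y : x != y -> fconnect s x y ->
  ncycle (tperm x y * s)%g = (ncycle s).+1.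
Proof. by move=> xy sxy; have := ncycle_tperm s x y; rewrite xy sxy /= addn0 addn1. Qed.

Lemma ncycleV s : ncycle s^-1%g = ncycle s.
Proof. by rewrite -!porbits_ncycle porbitsV. Qed.

Lemma ncycle1 : ncycle 1 = #|T|.
Proof.
apply: eq_card => x; rewrite !inE andbT; apply/eqP.
have /iter_findex <- := connect_root (frel (1%g : {perm T})) x.
by elim: (findex _ _ _) => //= n ->; rewrite perm1.
Qed.

Definition hrel s t : rel T := relU (frel s) (frel t).
Notation hconnect s t := (connect (hrel s t)).
Definition ncomp s t := n_comp (hrel s t) T.

Lemma hrel_sym s t : connect_sym (hrel s t).
Proof. by apply: relU_sym; apply: pfrel_sym. Qed.

Lemma hrel_l s t x : hconnect s t x (s x).
Proof. by apply: connect1; rewrite /hrel /= eqxx. Qed.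

Lemma hrel_r s t x : hconnect s t x (t x).
Proof. by apply: connect1; rewrite /hrel /= eqxx orbT. Qed.

Lemma hconnect_sub (e : rel T) s t :
    (forall x, connect e x (s x)) -> (forall x, connect e x (t x)) ->
  subrel (hconnect s t) (connect e).
Proof.
by move=> es et; apply: connect_sub => u v /orP[] /eqP <-.
Qed.

Lemma fconnect_sub (e : rel T) s :
  (forall x, connect e x (s x)) -> subrel (fconnect s) (connect e).
Proof. by move=> es; apply: connect_sub => u v /eqP <-. Qed.

Lemma fconnect_l s t : subrel (fconnect s) (hconnect s t).
Proof. by apply: fconnect_sub => x; apply: hrel_l. Qed.

Lemma fconnect_r s t : subrel (fconnect t) (hconnect s t).
Proof. by apply: fconnect_sub => x; apply: hrel_r. Qed.

Lemma fconnect_m s t : subrel (fconnect (s * t)%g) (hconnect s t).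
Proof.
apply: fconnect_sub => x; rewrite permM.
exact: connect_trans (hrel_l s t x) (hrel_r s t _).
Qed.

Lemma link_tperm (e : rel T) s x y z :
  (forall u, connect e u ((tperm x y * s)%g u)) -> connect (link e x y) z (s z).
Proof.
move=> es.
have [<-|nx] := eqVneq x z.
  apply: connect_trans (linkxy e x y) _; apply: connect_link.
  by have := es y; rewrite permM tpermR.
have [<-|ny] := eqVneq y z.
  have L : connect (link e x y) y x.
    by apply: connect1; rewrite /link /= !eqxx !orbT.
  apply: connect_trans L _; apply: connect_link.
  by have := es x; rewrite permM tpermL.
by apply: connect_link; have := es z; rewrite permM tpermD.
Qed.

Lemma tpermMK s x y : (tperm x y * (tperm x y * s))%g = s.
Proof. by rewrite mulgA tperm2 mul1g. Qed.

Lemma ncomp_tperm s t x y :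
  ncomp s t + ~~ hconnect s (tperm x y * t)%g x y
  = ncomp s (tperm x y * t)%g + ~~ hconnect s t x y.
Proof.
apply: n_comp_swap; try exact: hrel_sym.
  move=> u v /orP[] /eqP <-; first by apply: connect_link; apply: hrel_l.
  by apply: link_tperm => z; apply: hrel_r.
move=> u v /orP[] /eqP <-; first by apply: connect_link; apply: hrel_l.
by apply: link_tperm => z; rewrite tpermMK; apply: hrel_r.
Qed.

(** Conjugation by [s]: exchanging the successors of [x] and [y] around regions exchanges those of
    [s^-1 x] and [s^-1 y] around vertices, so a surgery on [t] is also a transposition of
    [s * t]. *)
Lemma tperm_mull s t x y :
  (s * (tperm x y * t))%g = (tperm (s^-1%g x) (s^-1%g y) * (s * t))%g.
Proof.
rewrite -tpermJ /conjg invgK; rewrite !mulgA; congr (_ * _)%g.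
by rewrite -!mulgA mulVg mulg1.
Qed.

Lemma hconnectV s t x y : hconnect s t (s^-1%g x) (s^-1%g y) = hconnect s t x y.
Proof.
have H z : hconnect s t (s^-1%g z) z.
  by have := hrel_l s t (s^-1%g z); rewrite permKV.
rewrite (same_connect (@hrel_sym s t) (H x)).
by rewrite (same_connect_r (@hrel_sym s t) (H y)).
Qed.

Definition moved s := #|[pred x | s x != x]|.

(** Induction on the points moved by [t]: the transposition of [x] with [t^-1 x] makes [x] a fixed
    point, splits a cycle of [t] and changes the number of cycles of [s * t] by one. If it merges
    two of these, [imp] shows that the components stay the same; otherwise at most one component is
    gained, which pays for two cycles. *)
Lemma genus_ineq s t : ncycle s + ncycle t + ncycle (s * t)%g <= #|T| + 2 * ncomp s t.
Proof.
have [n] := ubnP (moved t); elim: n t => // n IH t; rewrite ltnS => tn.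
case: (pickP [pred x | t x != x]) => [x /= tx|t1]; last first.
  have -> : t = 1%g.
    by apply/perm.permP => x; have /negbFE/eqP := t1 x; rewrite perm1.
  rewrite mulg1 ncycle1.
  have -> : ncomp s 1%g = ncycle s; last by lia.
  apply: eq_n_comp => u v; apply/idP/idP; last exact: fconnect_l.
  by apply: hconnect_sub => z; rewrite ?perm1 ?fconnect1.
pose y := (t^-1%g x); have ty : t y = x by rewrite permKV.
have xy : x != y by apply: contra tx => /eqP {1}->; rewrite ty.
pose t' := (tperm x y * t)%g.
have t'x : t' x = x by rewrite permM tpermL.
have /IH H : moved t' < n.
  apply: leq_trans tn; apply: proper_card; apply/properP; split.
    apply/subsetP => z; rewrite !inE permM; case: tpermP => [->|->|_ _ //].
      by rewrite ty eqxx.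
    by move=> _; rewrite ty.
  by exists x; rewrite !inE ?tx // t'x eqxx.
have zt := ncycle_tperm t x y; have ct := ncomp_tperm s t x y.
have zs := ncycle_tperm (s * t)%g (s^-1%g x) (s^-1%g y).
rewrite -tperm_mull -/t' in zs; rewrite -/t' in zt ct.
have zs' := ncycle_tperm (s * t')%g (s^-1%g x) (s^-1%g y).
rewrite -tperm_mull tpermMK in zs'.
rewrite (inj_eq (@perm_inj _ _)) in zs zs'.
have txy : fconnect t x y by rewrite pfrel_sym; have := fconnect1 t y; rewrite ty.
have cxy : hconnect s t x y by apply: fconnect_r.
rewrite txy cxy xy in zt ct zs zs' *.
have imp : fconnect (s * t')%g (s^-1%g x) (s^-1%g y) -> hconnect s t' x y.
  by move/fconnect_m; rewrite hconnectV.
move: imp zt ct zs zs' H.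
case: (fconnect (s * t')%g _ _); case: (hconnect s t' x y);
case: (fconnect (s * t)%g _ _) => //=; lia.
Qed.

(* s reverses edges, t follows the boundaries of the regions on the left, so that
   s * t, which applies s first, turns around vertices. The map may be
   disconnected, each component being spherical. *)
Definition planar s t :=
  ncycle s + ncycle t + ncycle (s * t)%g == #|T| + 2 * ncomp s t.

(** The case left out, with [x] and [y] in one component but sharing neither region nor vertex, adds
    a handle: regions and vertices both merge. In the other cases the cycle counts cannot drop
    without the number of components, and [genus_ineq] gives the opposite bound. *)
Lemma planar_tperm s t x y : planar s t ->
    [|| ~~ hconnect s t x y, fconnect t x y
      | fconnect (s * t)%g (s^-1%g x) (s^-1%g y)] ->
  planar s (tperm x y * t)%g.
Proof.
have [<-|xy] := eqVneq x y; first by rewrite tperm1 mul1g.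
rewrite /planar => /eqP pl cond; pose t' := (tperm x y * t)%g.
have H := genus_ineq s t'.
have zt := ncycle_tperm t x y; have ct := ncomp_tperm s t x y.
have zt' := ncycle_tperm t' x y; rewrite tpermMK in zt'.
have zs := ncycle_tperm (s * t)%g (s^-1%g x) (s^-1%g y).
rewrite -tperm_mull -/t' in zs; rewrite -/t' in zt ct *.
have zs' := ncycle_tperm (s * t')%g (s^-1%g x) (s^-1%g y).
rewrite -tperm_mull tpermMK in zs'.
rewrite (inj_eq (@perm_inj _ _)) in zs zs'.
have i1 : fconnect (s * t')%g (s^-1%g x) (s^-1%g y) -> hconnect s t' x y.
  by move/fconnect_m; rewrite hconnectV.
have i2 : fconnect (s * t)%g (s^-1%g x) (s^-1%g y) -> hconnect s t x y.
  by move/fconnect_m; rewrite hconnectV.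
have i3 : fconnect t x y -> hconnect s t x y by apply: fconnect_r.
have i4 : fconnect t' x y -> hconnect s t' x y by apply: fconnect_r.
move: cond i1 i2 i3 i4 zt zt' ct zs zs' H pl; rewrite xy.
case: (fconnect (s * t')%g _ _); case: (hconnect s t' x y);
case: (fconnect (s * t)%g _ _); case: (hconnect s t x y);
case: (fconnect t' x y); case: (fconnect t x y) => //=; lia.
Qed.

End Components.
Notation hconnect s t := (connect (hrel s t)).

(** * Exchange of the edge and region permutations *)

Section Duality.
Variable T : finType.
Implicit Types (s t : {perm T}).

Lemma fconnectV s : fconnect s^-1%g =2 fconnect s.
Proof. by move=> x y; rewrite -!porbit_fconnect porbitV. Qed.

Lemma hconnect_inv s t : hconnect t^-1%g s^-1%g =2 hconnect s t.
Proof.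
have H (u v : {perm T}) : subrel (hconnect v^-1%g u^-1%g) (hconnect u v).
  apply: hconnect_sub => z; [apply: fconnect_r | apply: fconnect_l];
  by rewrite -fconnectV fconnect1.
move=> x y; apply/idP/idP; first exact: H.
by have := H t^-1%g s^-1%g; rewrite !invgK; apply.
Qed.

(** The product of the new pair is the inverse of [s * t], so the vertices are kept while edges and
    regions change roles; surgeries on [s] thus reduce to surgeries on [t]. *)
Lemma planar_inv s t : planar t^-1%g s^-1%g = planar s t.
Proof.
rewrite /planar -invMg !ncycleV [ncycle t + _]addnC; congr (_ == _ + 2 * _).
exact/eq_n_comp/hconnect_inv.
Qed.

Lemma planar_tperm_l s t x y : planar s t ->
    [|| ~~ hconnect s t x y, fconnect s x y
      | fconnect (s * t)%g (t x) (t y)] ->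
  planar (s * tperm x y)%g t.
Proof.
move=> pl cond; rewrite -planar_inv invMg tpermV.
apply: planar_tperm; first by rewrite planar_inv.
by rewrite hconnect_inv fconnectV -invMg fconnectV invgK.
Qed.

End Duality.

(** * Disjoint unions of maps *)

Section Glue.
Variables (T T1 T2 : finType) (h1 : T1 -> T) (h2 : T2 -> T).
Hypotheses (inj1 : injective h1) (inj2 : injective h2).
Hypothesis cod : forall x, (x \in codom h1) = (x \notin codom h2).

Lemma n_comp_codom (U : finType) (h : U -> T) (e : rel T) (e' : rel U) :
    injective h -> connect_sym e -> connect_sym e' -> closed e [in codom h] ->
    (forall u v, e (h u) (h v) = e' u v) ->
  n_comp e [in codom h] = n_comp e' U.
Proof.
move=> ih se se' cl ee'.
rewrite (adjunction_n_comp h se se' cl).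
  by apply: eq_n_comp_r => u; rewrite !inE codom_f.
by apply: strict_adjunction => // u v _; rewrite ee'.
Qed.

Lemma n_comp_glue (e : rel T) (e1 : rel T1) (e2 : rel T2) :
    connect_sym e -> connect_sym e1 -> connect_sym e2 ->
    closed e [in codom h1] ->
    (forall u v, e (h1 u) (h1 v) = e1 u v) ->
    (forall u v, e (h2 u) (h2 v) = e2 u v) ->
  n_comp e T = n_comp e1 T1 + n_comp e2 T2.
Proof.
move=> se se1 se2 cl ee1 ee2; rewrite (n_compC [in codom h1]).
rewrite (n_comp_codom inj1 se se1 cl ee1); congr (_ + _).
have E : [predC [in codom h1]] =i [in codom h2] by move=> x; rewrite !inE cod negbK.
rewrite (eq_n_comp_r E); apply: n_comp_codom => // x y exy.
by rewrite -!E !inE (cl _ _ exy).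
Qed.

Variables (s t : {perm T}) (s1 t1 : {perm T1}) (s2 t2 : {perm T2}).
Hypotheses (hs1 : forall u, s (h1 u) = h1 (s1 u)) (ht1 : forall u, t (h1 u) = h1 (t1 u)).
Hypotheses (hs2 : forall u, s (h2 u) = h2 (s2 u)) (ht2 : forall u, t (h2 u) = h2 (t2 u)).

Lemma closed_codom (U : finType) (h : U -> T) (r : {perm T}) (r' : {perm U}) :
  (forall u, r (h u) = h (r' u)) -> fclosed r [in codom h].
Proof.
move=> hr x y /eqP <-; change ((x \in codom h) = (r x \in codom h)).
apply/codomP/codomP => -[u]; first by move=> ->; exists (r' u); rewrite hr.
rewrite -(permKV r' u) -hr => /perm_inj ->; by exists (r'^-1%g u).
Qed.

Lemma ncycle_glue (r : {perm T}) (r1 : {perm T1}) (r2 : {perm T2}) :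
  (forall u, r (h1 u) = h1 (r1 u)) -> (forall u, r (h2 u) = h2 (r2 u)) ->
  ncycle r = ncycle r1 + ncycle r2.
Proof.
move=> hr1 hr2; apply: n_comp_glue; try exact: pfrel_sym.
- exact: closed_codom hr1.
- by move=> u v; rewrite /= hr1 (inj_eq inj1).
- by move=> u v; rewrite /= hr2 (inj_eq inj2).
Qed.

Lemma ncomp_glue : ncomp s t = ncomp s1 t1 + ncomp s2 t2.
Proof.
apply: n_comp_glue; try exact: hrel_sym.
- by move=> x y /orP[]; [apply: (closed_codom hs1) | apply: (closed_codom ht1)].
- by move=> u v; rewrite /hrel /= hs1 ht1 !(inj_eq inj1).
- by move=> u v; rewrite /hrel /= hs2 ht2 !(inj_eq inj2).
Qed.

Lemma card_glue : #|T| = #|T1| + #|T2|.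
Proof.
rewrite -(card_codom inj1) -(card_codom inj2) -(cardC [in codom h1]); congr (_ + _).
by apply: eq_card => x; rewrite !inE cod negbK.
Qed.

(** All counts are additive, and by the genus inequality on each part a sum can attain its bound
    only if both summands do. *)
Lemma planar_glueE : planar s t = planar s1 t1 && planar s2 t2.
Proof.
have g1 := genus_ineq s1 t1; have g2 := genus_ineq s2 t2.
rewrite /planar ncomp_glue card_glue (ncycle_glue hs1 hs2) (ncycle_glue ht1 ht2).
have -> : ncycle (s * t)%g = ncycle (s1 * t1)%g + ncycle (s2 * t2)%g.
  by apply: ncycle_glue => u; rewrite !permM ?hs1 ?ht1 ?hs2 ?ht2.
by apply/eqP/andP => [H|[/eqP H1 /eqP H2]]; [split; apply/eqP|]; lia.
Qed.

End Glue.

(** * Restriction to an invariant set *)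

Section Restrict.
Variable T : finType.
Implicit Types (s t : {perm T}).

Lemma restrict_perm (S : {pred T}) s : fclosed s S ->
  {s' : {perm {x | x \in S}} | forall u, s (val u) = val (s' u)}.
Proof.
move=> cl; have H (u : {x | x \in S}) : s (val u) \in S.
  by rewrite -(fclosed1 cl) (valP u).
have inj : injective (fun u => exist (fun x => x \in S) (s (val u)) (H u)).
  by move=> u v [] /perm_inj/val_inj.
by exists (perm inj) => u; rewrite permE.
Qed.

Lemma codom_sig (S : {pred T}) x : (x \in codom (fun u : {x | x \in S} => val u)) = (x \in S).
Proof.
apply/codomP/idP => [[u ->]|xS]; first exact: valP.
by exists (exist _ x xS).
Qed.

Lemma planar_restrict (S : {pred T}) s t
    (s' t' : {perm {x | x \in S}}) :
    (forall u, s (val u) = val (s' u)) -> (forall u, t (val u) = val (t' u)) ->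
  planar s t -> planar s' t'.
Proof.
move=> hs ht.
have cl (r : {perm T}) (r' : {perm {x | x \in S}}) :
    (forall u, r (val u) = val (r' u)) -> fclosed r [predC S].
  move=> hr; apply: predC_closed => x y xy.
  by have := closed_codom hr xy; rewrite -(codom_sig S x) -(codom_sig S y).
have [s2 hs2] := restrict_perm (cl _ _ hs); have [t2 ht2] := restrict_perm (cl _ _ ht).
rewrite (planar_glueE (h1 := val) (h2 := val) val_inj val_inj _ hs ht hs2 ht2).
  by case/andP.
by move=> x; rewrite !codom_sig !inE negbK.
Qed.

Lemma ncycle_restrict (S : {pred T}) s (s' : {perm {x | x \in S}}) :
  (forall u, s (val u) = val (s' u)) -> ncycle s' = fcard s S.
Proof.
move=> hs.
have <- : n_comp (frel s) [in codom (fun u : {x | x \in S} => val u)] = ncycle s'.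
  apply: n_comp_codom; try exact: pfrel_sym.
  - exact: val_inj.
  - exact: closed_codom hs.
  - by move=> u v; rewrite /= hs (inj_eq val_inj).
by apply: eq_n_comp_r => x; exact: codom_sig.
Qed.

Lemma fconnect_val (U : finType) (h : U -> T) s (s' : {perm U}) u v :
  injective h -> (forall u, s (h u) = h (s' u)) ->
  fconnect s (h u) (h v) = fconnect s' u v.
Proof.
move=> ih hs; have it n : iter n s (h u) = h (iter n s' u).
  by elim: n => //= n ->; rewrite hs.
apply/idP/idP => /iter_findex; last by move=> <-; rewrite -it fconnect_iter.
by rewrite it => /ih <-; rewrite fconnect_iter.
Qed.

Lemma orbit_val (U : finType) (h : U -> T) s (s' : {perm U}) u :
  injective h -> (forall u, s (h u) = h (s' u)) ->
  orbit s (h u) = map h (orbit s' u).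
Proof.
move=> ih hs; rewrite /orbit.
have -> : order s (h u) = order s' u.
  rewrite /order -(card_image ih); apply: eq_card => x.
  apply/idP/imageP => [xs|[v uv ->]]; last by rewrite /in_mem /= (fconnect_val _ _ ih hs).
  have /iter_findex := xs; move: (findex _ _ _) => n <-.
  have it : iter n s (h u) = h (iter n s' u) by elim: (n) => //= m ->; rewrite hs.
  by exists (iter n s' u); rewrite // /in_mem /= fconnect_iter.
by move: (order s' u) => n; elim: n u => //= n IH u; rewrite hs IH.
Qed.

End Restrict.

(** * Orbits, vertex paths and plane trees *)

Section Orbits.
Variable T : finType.
Implicit Types (s t : {perm T}).

Lemma orbit_fcycle s d q : fcycle s (d :: q) -> uniq (d :: q) ->
  orbit s d = d :: q.
Proof.
by move=> c u; rewrite (orbitE c u) ?mem_head //= eqxx rot0.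
Qed.

Lemma fcycle_orbit s d : fcycle s (orbit s d).
Proof. by apply: cycle_orbit; apply: perm_inj. Qed.

Lemma orbit_cons s d : orbit s d = d :: behead (orbit s d).
Proof. by rewrite /orbit -orderSpred. Qed.

Lemma orbit_eq_in s t d : (forall u, fconnect s d u -> t u = s u) ->
  orbit t d = orbit s d.
Proof.
move=> H; have U := orbit_uniq s d; have C := fcycle_orbit s d.
have C' : fcycle t (orbit s d).
  rewrite -(@eq_in_cycle _ (mem (orbit s d)) (frel s) (frel t)) ?allss //.
  by move=> u v; rewrite -fconnect_orbit => /H /= ->.
by rewrite orbit_cons in U C C' *; apply: orbit_fcycle.
Qed.

Lemma orbit_rot s d p q e : orbit s d = p ++ e :: q -> orbit s e = e :: q ++ p.
Proof.
move=> E; have U := orbit_uniq s d; have C := fcycle_orbit s d; rewrite E in U C.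
apply: orbit_fcycle; last by rewrite -cat_cons uniq_catC.
by rewrite -cat_cons -rot_size_cat rot_cycle.
Qed.

Lemma orbit_connect s d e : fconnect s d e -> exists p q,
  orbit s d = p ++ q /\ orbit s e = q ++ p.
Proof.
rewrite fconnect_orbit => eo; set i := index e (orbit s d).
have E : orbit s d = take i (orbit s d) ++ e :: drop i.+1 (orbit s d).
  by rewrite -(drop_index eo) cat_take_drop.
exists (take i (orbit s d)), (e :: drop i.+1 (orbit s d)); split => //.
exact: orbit_rot E.
Qed.

Lemma fpath_tperm s x y u p : x \notin p -> y \notin p ->
  fpath (tperm x y * s)%g u (rcons p x) = fpath s (tperm x y u) (rcons p x).
Proof.
elim: p u => [|z p IH] u /=; first by rewrite permM.
rewrite !inE !negb_or => /andP[xz xp] /andP[yz yp].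
by rewrite permM IH // (tpermD xz yz).
Qed.

Lemma fcycle_cat_rcons s p q x y :
  fcycle s (rcons p x ++ rcons q y) =
  fpath s y (rcons p x) && fpath s x (rcons q y).
Proof. by rewrite (cycle_path x) cat_path !last_cat !last_rcons. Qed.

Lemma fcycle_rcons s p x : fcycle s (rcons p x) = fpath s x (rcons p x).
Proof. by rewrite (cycle_path x) last_rcons. Qed.

(** The transposition exchanges the images of [x] and [y]. With these at the ends of the two
    segments, one cycle is cut into two or, read backwards, two cycles are joined. *)
Lemma fcycle_tperm s p q x y : uniq (rcons p x ++ rcons q y) ->
  fcycle s (rcons p x ++ rcons q y) =
  fcycle (tperm x y * s)%g (rcons p x) && fcycle (tperm x y * s)%g (rcons q y).
Proof.
rewrite cat_uniq !rcons_uniq => /and3P[/andP[xp _] /hasPn H /andP[yq _]].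
have yp : y \notin p.
  have := H y; rewrite !mem_rcons !inE eqxx => /(_ isT).
  by rewrite negb_or => /andP[].
have xq : x \notin q.
  apply/negP => xq; have := H x; rewrite !mem_rcons !inE xq orbT eqxx.
  by move/(_ isT).
rewrite fcycle_cat_rcons !fcycle_rcons fpath_tperm // tpermL.
by rewrite tpermC fpath_tperm // tpermL.
Qed.

Lemma tpermMD s x y u : u != x -> u != y -> (tperm x y * s)%g u = s u.
Proof. by move=> ux uy; rewrite permM tpermD // eq_sym. Qed.

Lemma orbit_tperm s x y d : ~~ fconnect s d x -> ~~ fconnect s d y ->
  orbit (tperm x y * s)%g d = orbit s d.
Proof.
move=> dx dy; apply: orbit_eq_in => u du.
by apply: tpermMD; [apply: contraNneq dx | apply: contraNneq dy] => <-.
Qed.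

Lemma orbit_split s p q x y : fcycle s (rcons p x ++ rcons q y) ->
    uniq (rcons p x ++ rcons q y) ->
  let t := (tperm x y * s)%g in
  [/\ fcycle t (rcons p x), fcycle t (rcons q y) &
      forall d, d \notin rcons p x ++ rcons q y -> orbit t d = orbit s d].
Proof.
move=> C U t; have := C; rewrite fcycle_tperm // => /andP[cp cq]; split => // d dn.
have H z : z \in rcons p x ++ rcons q y -> ~~ fconnect s d z.
  move=> zi; rewrite pfrel_sym (fconnect_cycle C zi) //.
by apply: orbit_tperm; apply: H; rewrite mem_cat !mem_rcons !inE eqxx ?orbT.
Qed.

Lemma orbit_merge s p q x y : fcycle s (rcons p x) -> fcycle s (rcons q y) ->
    uniq (rcons p x ++ rcons q y) ->
  let t := (tperm x y * s)%g in
  fcycle t (rcons p x ++ rcons q y) /\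
  (forall d, d \notin rcons p x ++ rcons q y -> orbit t d = orbit s d).
Proof.
move=> cp cq U t; split; first by rewrite fcycle_tperm // tpermMK cp cq.
move=> d; rewrite mem_cat negb_or => /andP[dp dq].
apply: orbit_tperm; rewrite pfrel_sym.
  by rewrite (fconnect_cycle cp) // mem_rcons mem_head.
by rewrite (fconnect_cycle cq) // mem_rcons mem_head.
Qed.

End Orbits.

(** * Edge paths between vertices, and plane trees *)

Section Paths.
Variables (T : finType) (s t : {perm T}).

Definition same_vertex x y := fconnect (s * t)%g x y.

(** Vertices being orbits, a dart stands for its origin: [p] leads from the origin of [x] to that of
    [y]. The end of a dart [d] is the origin of [s d]. *)
Fixpoint vpath (x : T) (p : seq T) (y : T) : bool :=
  if p is d :: p' then same_vertex x d && vpath (s d) p' y else same_vertex x y.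

Definition pend x (p : seq T) := last x (map s p).

Lemma sv_sym : symmetric same_vertex.
Proof. exact: pfrel_sym. Qed.

Lemma sv_refl x : same_vertex x x.
Proof. exact: connect0. Qed.

Lemma sv_trans : transitive same_vertex.
Proof. exact: connect_trans. Qed.

Lemma vpath_svl x x' p y : same_vertex x x' -> vpath x p y = vpath x' p y.
Proof.
by case: p => [|d p] /= xx'; rewrite /same_vertex (same_connect (@pfrel_sym _ _) xx').
Qed.

Lemma vpath_svr x p y y' : same_vertex y y' -> vpath x p y = vpath x p y'.
Proof.
move=> yy'; elim: p x => [|d p IH] x /=; last by rewrite IH.
by rewrite /same_vertex (same_connect_r (@pfrel_sym _ _) yy').
Qed.

Lemma vpath_cat x p q y :
  vpath x (p ++ q) y = vpath x p (pend x p) && vpath (pend x p) q y.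
Proof.
elim: p x => [|d p IH] x; first by rewrite /= sv_refl.
by rewrite /= IH andbA.
Qed.

Lemma vpath_pend x p y : vpath x p y = vpath x p (pend x p) && same_vertex (pend x p) y.
Proof. by rewrite -{1}[p]cats0 vpath_cat. Qed.

Lemma vpath_comp x p z q y : vpath x p z -> vpath z q y -> vpath x (p ++ q) y.
Proof.
rewrite vpath_pend vpath_cat => /andP[-> pz] zq.
by rewrite (vpath_svl _ _ pz).
Qed.

Lemma vpath_catE x p d q y :
  vpath x (p ++ d :: q) y = vpath x p d && vpath d (d :: q) y.
Proof.
rewrite vpath_cat [in RHS]vpath_pend /= sv_refl -andbA; congr (_ && _).
Qed.

Hypothesis sK : involutive s.

Lemma sv_next x : same_vertex (s x) (t x).
Proof. by have := fconnect1 (s * t)%g (s x); rewrite permM sK. Qed.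

Lemma vpath_fpath x p : fpath t x p -> vpath (s x) p (s (last x p)).
Proof.
elim: p x => [|y p IH] x /=; first by rewrite sv_refl.
by move=> /andP[/eqP <- /IH ->]; rewrite sv_next.
Qed.

Lemma vpath_orbit x : vpath x (orbit t x) x.
Proof.
have := fcycle_orbit t x; rewrite orbit_cons; set q := behead _ => /=.
rewrite rcons_path sv_refl => /andP[/vpath_fpath xq /eqP lx].
by rewrite (vpath_svr _ _ (sv_next (last x q))) lx in xq.
Qed.

(* Y is the component of d after erasing the edge d: as there is a single region,
   this adds two cycles, and the genus inequality then forces one more component. *)
Lemma tree_cut d : planar s t -> (forall x y, fconnect t x y) -> s d != d ->
  exists Y : pred T,
    [/\ Y d, ~~ Y (s d), forall u v, same_vertex u v -> Y u = Y v &
        forall z, z != d -> z != s d -> Y (s z) = Y z].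
Proof.
move=> pl t1 sd; pose s' := (tperm d (s d) * s)%g; pose t' := (tperm d (s d) * t)%g.
have sV : s^-1%g = s.
  by apply/perm.permP => x; apply: (@perm_inj _ s); rewrite permKV sK.
have st : (s' * t' = s * t)%g.
  rewrite /s' /t' -{1}(sK d) tpermC -{1 2}sV -{1}[s]mulg1.
  have := tperm_mull s 1 d (s d); rewrite !mulg1 !sV sK tpermC => <-.
  by rewrite -mulgA tpermMK.
have dsd : fconnect s d (s d) by apply: fconnect1.
have cst : hconnect s t d (s d) by apply: fconnect_l.
have zs := ncycle_tperm s d (s d); have zt := ncycle_tperm t d (s d).
rewrite -/s' dsd in zs; rewrite -/t' t1 in zt.
have H := genus_ineq s' t'; rewrite st in H.
have c : ncomp s t + ~~ hconnect s' t' d (s d) = ncomp s' t' + ~~ hconnect s t d (s d).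
  apply: n_comp_swap; try exact: hrel_sym.
    move=> u v /orP[] /eqP <-; apply: link_tperm => z; [exact: hrel_l | exact: hrel_r].
  move=> u v /orP[] /eqP <-; apply: link_tperm => z;
    rewrite tpermMK; [exact: hrel_l | exact: hrel_r].
move: pl; rewrite /planar => /eqP pl.
have nc : ~~ hconnect s' t' d (s d).
  apply/negP => cc; rewrite cc cst eq_sym sd /= in c zs zt; lia.
exists (hconnect s' t' d); split => //.
- by move=> u v; rewrite /same_vertex -st => /fconnect_m/(same_connect_r (@hrel_sym _ _ _)).
- move=> z zd zsd; rewrite -(tpermMD s zd zsd).
  exact/esym/(same_connect_r (@hrel_sym _ _ _))/hrel_l.
Qed.

Lemma cut_cross (Y : pred T) : (forall u v, same_vertex u v -> Y u = Y v) ->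
  forall x p y, vpath x p y -> ~~ Y x -> Y y ->
  exists q z r, p = q ++ z :: r /\ ~~ Y z && Y (s z).
Proof.
move=> Yv x p; elim: p x => [|d p IH] x y /=; first by move=> /Yv -> /negP.
move=> /andP[/Yv xd dp] nYx Yy; rewrite xd in nYx.
case: (boolP (Y (s d))) => Yd; first by exists [::], d, p; rewrite nYx.
by have [q [z [r [-> H]]]] := IH _ _ dp Yd Yy; exists (d :: q), z, r.
Qed.

(** After its first dart [d] the path has to come back across the cut of [tree_cut], which only
    [s d] does in that direction. The part in between is a shorter closed path: it is empty, or it
    contains a backtrack by induction. *)
Lemma tree_backtrack x p : planar s t -> (forall x y, fconnect t x y) ->
    (forall d, s d != d) -> vpath x p x -> p != [::] ->
  exists u d v, p = u ++ [:: d; s d] ++ v.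
Proof.
move=> pl t1 sd.
have [n] := ubnP (size p); elim: n x p => // n IH x [|d q] //.
rewrite ltnS => sz /= /andP[xd dq] _.
have [Y [Yd nYd Yv Ys]] := tree_cut pl t1 (sd d).
have dq' : vpath (s d) q d by rewrite -(vpath_svr _ _ xd).
have [q1 [z [r [E /andP[nYz Ysz]]]]] := cut_cross Yv dq' nYd Yd.
have zE : z = s d.
  apply/eqP; apply: contraT => zsd.
  have zd : z != d by apply: contra nYz => /eqP ->.
  by rewrite -(Ys z zd zsd) Ysz in nYz.
subst z; case: (altP (q1 =P [::])) => [q0|q0].
  by exists [::], d, r; rewrite E q0.
have q1c : vpath (s d) q1 (s d).
  by move: dq'; rewrite E vpath_catE => /andP[].
have sz1 : size q1 < n by move: sz; rewrite E /= size_cat /=; lia.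
have [u [d' [v E1]]] := IH _ _ sz1 q1c q0.
by exists (d :: u), d', (v ++ s d :: r); rewrite E E1 /= -!catA.
Qed.

End Paths.

(** * Simple connectivity *)

Section Slide.
Variables (T : finType) (s t : {perm T}).
Hypothesis sK : involutive s.

Lemma invol_inv : s^-1%g = s.
Proof. by apply/perm.permP => x; apply: (@perm_inj _ s); rewrite permKV sK. Qed.

Lemma ncycle_le1 : ncycle t <= 1 -> forall x y, fconnect t x y.
Proof.
move=> t1 x y; apply: contraTT t1 => nxy; rewrite -ltnNge.
by apply/(fcard_gt1P (@perm_inj _ t)) => //; exists x => //; exists y.
Qed.

Lemma ncycle_gt1 b : 1 < ncycle t -> exists x, ~~ fconnect t b x.
Proof.
have cl : fclosed t T by [].
case/(fcard_gt1P (@perm_inj _ t) cl) => x _ [y _ nxy].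
case: (boolP (fconnect t b x)) => [bx|]; last by exists x.
exists y; apply: contra nxy => bxy.
by rewrite (same_connect (@pfrel_sym _ t) (y := b)) // pfrel_sym.
Qed.

Lemma ncycle_gt0 (b : T) : 0 < ncycle t.
Proof.
have cl : fclosed t T by [].
by apply/(fcard_gt0P (@perm_inj _ t) cl); exists b.
Qed.

Lemma exists_border b x : (forall x y, hconnect s t x y) -> ~~ fconnect t b x ->
  exists2 z, ~~ fconnect t b z & fconnect t b (s z).
Proof.
move=> conn nbx.
case: (pickP [pred z | ~~ fconnect t b z && fconnect t b (s z)]) => [z /andP[]|H].
  by exists z.
have cl : closed (hrel s t) (fconnect t b).
  apply: intro_closed (@hrel_sym _ s t) _ _ => u v /orP[] /eqP <-.
    move=> bu; have := H (s u); rewrite /= sK.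
    by have -> : fconnect t b u := bu; rewrite andbT => /negbFE.
  move=> bu; have {}bu : fconnect t b u := bu. apply: connect_trans bu (fconnect1 _ _).
by have := closed_connect cl (conn b x); rewrite !inE connect0 (negbTE nbx).
Qed.

Variable x : T.
Hypothesis nx : ~~ fconnect t x (s x).
Let y := t^-1%g (s x).
(* The end of x is detached from its vertex and becomes a leaf, which merges the
   regions on the two sides of x. *)
Definition slide := (tperm x (t^-1%g (s x)) * t)%g.

Let ty : t y = s x.
Proof. by rewrite permKV. Qed.

Let nxy : ~~ fconnect t x y.
Proof. by apply: contra nx => xy; rewrite -ty; apply: connect_trans xy (fconnect1 _ _). Qed.

Let xy : x != y.
Proof. by apply: contraNneq nxy => ->. Qed.

Lemma slide_x : slide x = s x.
Proof. by rewrite permM tpermL. Qed.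

Lemma slide_y : slide (t^-1%g (s x)) = t x.
Proof. by rewrite permM tpermR. Qed.

Lemma slide_ncycle : ncycle t = (ncycle slide).+1.
Proof. by have := ncycle_tperm t x y; rewrite nxy xy -/slide; lia. Qed.

Lemma slide_connect : fconnect slide x (t^-1%g (s x)).
Proof.
have := ncycle_tperm slide x y; rewrite tpermMK slide_ncycle xy.
by case: (fconnect slide x y) => //=; lia.
Qed.

Lemma slide_fconnect : subrel (fconnect t) (fconnect slide).
Proof.
apply: fconnect_sub => z.
have H : connect (link (frel slide) x y) z (t z).
  by apply: link_tperm => u; apply: fconnect1.
have sub : subrel (frel slide) (fconnect slide) by move=> u v; apply: connect1.
exact: link_subl (@pfrel_sym _ slide) sub slide_connect _ _ H.
Qed.

Lemma slide_hconnect : subrel (hconnect s t) (hconnect s slide).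
Proof.
apply: hconnect_sub => z; first exact: hrel_l.
by apply: fconnect_r; apply: slide_fconnect; apply: fconnect1.
Qed.

Lemma slide_planar : planar s t -> planar s slide.
Proof.
move=> pl; apply: planar_tperm => //; apply/or3P; apply: Or33.
rewrite invol_inv pfrel_sym.
by have := fconnect1 (s * t)%g (s y); rewrite permM sK ty.
Qed.

Lemma slide_sv_sub u v : same_vertex s slide u v -> same_vertex s t u v.
Proof.
move: u v; apply: fconnect_sub => u; rewrite permM.
have [->|ux] := eqVneq u (s x); first by rewrite sK slide_x connect0.
have [E|uy] := eqVneq (s u) y.
  rewrite E slide_y -[x in t x]sK -ty.
  have := fconnect1 (s * t)%g u; rewrite permM E => h1.
  by apply: connect_trans h1 _; have := fconnect1 (s * t)%g (t y); rewrite permM.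
rewrite tpermMD //; last by apply: contra ux => /eqP <-; rewrite sK.
by have := fconnect1 (s * t)%g u; rewrite permM.
Qed.

(** [s x] is the only dart to leave its vertex. The induction follows the old rotation around the
    vertex and replaces [s x] by its predecessor [s y]. *)
Lemma slide_sv u v : u != s x -> v != s x ->
  same_vertex s t u v -> same_vertex s slide u v.
Proof.
move=> ux vx /iter_findex; move: (findex _ _ _) => n E.
suff H : let w := iter n (s * t)%g u in
    same_vertex s slide u (if w == s x then s y else w).
  by move: H; rewrite /= E (negbTE vx).
elim: n {E} => [|n IH] /=; first by rewrite (negbTE ux) sv_refl.
move: IH => /=; set w := iter n _ u; rewrite permM.
have [wx|wx] := eqVneq w (s x).
  have h : same_vertex s slide (s y) (t x).
    by have := fconnect1 (s * slide)%g (s y); rewrite permM sK slide_y.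
  rewrite wx sK; case: eqP => // _ uy; exact: sv_trans uy h.
have [wy|wy] := eqVneq (s w) y; first by rewrite wy ty eqxx -wy sK.
have tw : slide (s w) = t (s w).
  by rewrite tpermMD //; apply: contra wx => /eqP <-; rewrite sK.
case: eqP => [E|_] uw.
  by case/eqP: wy; apply: (@perm_inj _ t); rewrite ty.
apply: sv_trans uw _.
by have := fconnect1 (s * slide)%g w; rewrite permM tw.
Qed.

End Slide.

(** * Homotopies with fixed ends *)

Section Homotopy.
Variables (T : finType) (s : {perm T}).
Hypothesis sK : involutive s.
Implicit Types t : {perm T}.

Definition elem_step (t : {perm T}) (b : T) (p q : seq T) : Prop :=
  exists u k v, [/\ p = u ++ k ++ v, q = u ++ v &
    (exists d, k = [:: d; s d]) \/
    (exists2 d, ~~ fconnect t b d & k = orbit t d)].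

(** Unlike [homotopy_step], this also relates paths that are not closed, and keeps their ends, so
    that homotopies can be pasted into longer paths. The 2-cells are all regions but that of [b]. *)
Definition path_homotopy t b x y : seq T -> seq T -> Prop :=
  clos_refl_sym_trans _ (fun p q =>
    [/\ vpath s t x p y, vpath s t x q y & elem_step t b p q]).

Lemma ph_vpath t b x y p q : path_homotopy t b x y p q ->
  vpath s t x p y = vpath s t x q y.
Proof. by elim=> // [p' q' [-> ->] //|? ? ? _ -> _ ->]. Qed.

Lemma ph_ctx t b x y p q w z u v : path_homotopy t b x y p q ->
    vpath s t w u x -> vpath s t y v z ->
  path_homotopy t b w z (u ++ p ++ v) (u ++ q ++ v).
Proof.
move=> + wu yv; elim=> {p q} [p q [xp xq [u' [k [v' [E1 E2 H]]]]]|p|p q _ IH|p q r _ IH1 _ IH2].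
- apply: rst_step; split.
  + exact: vpath_comp wu (vpath_comp xp yv).
  + exact: vpath_comp wu (vpath_comp xq yv).
  + by exists (u ++ u'), k, (v' ++ v); rewrite E1 E2 -!catA.
- exact: rst_refl.
- exact: rst_sym.
- exact: rst_trans IH1 IH2.
Qed.

Lemma ph_sv t b x x' p q : same_vertex s t x x' ->
  path_homotopy t b x x p q -> path_homotopy t b x' x' p q.
Proof.
move=> xx'; elim=> {p q} [p q [xp xq H]|p|p q _ IH|p q r _ IH1 _ IH2].
- by apply: rst_step; split; rewrite // -(vpath_svl _ _ xx') -(vpath_svr _ _ xx').
- exact: rst_refl.
- exact: rst_sym.
- exact: rst_trans IH1 IH2.
Qed.

Definition pinv (p : seq T) := rev (map s p).

Lemma pinv_cons d p : pinv (d :: p) = pinv p ++ [:: s d].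
Proof. by rewrite /pinv /= rev_cons cats1. Qed.

Lemma vpath_pinv t x p y : vpath s t x p y -> vpath s t y (pinv p) x.
Proof.
elim: p x => [|d p IH] x /=; first by rewrite sv_sym.
move=> /andP[xd /IH H]; rewrite pinv_cons; apply: vpath_comp H _.
by rewrite /= sv_refl sK sv_sym.
Qed.

Lemma ph_pinv t b x p y : vpath s t x p y -> path_homotopy t b x x (p ++ pinv p) [::].
Proof.
elim: p x => [|d p IH] x /=; first by move=> _; apply: rst_refl.
move=> /andP[xd xp]; rewrite pinv_cons catA.
have xd1 : vpath s t x [:: d] (s d) by rewrite /= xd sv_refl.
have dx1 : vpath s t (s d) [:: s d] x by rewrite /= sK sv_refl sv_sym.
apply: rst_trans (ph_ctx (IH _ xp) xd1 dx1) _; apply: rst_step; split.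
- exact: vpath_comp xd1 dx1.
- exact: sv_refl.
- by exists [::], [:: d; s d], [::]; split => //; left; exists d.
Qed.

Lemma ph_step t b x y p q : vpath s t x p y -> vpath s t x q y ->
  elem_step t b p q -> path_homotopy t b x y p q.
Proof. by move=> xp xq H; apply: rst_step. Qed.

Lemma ph_orbit t b x : ~~ fconnect t b x -> path_homotopy t b x x (orbit t x) [::].
Proof.
move=> bx; apply: ph_step; [exact: vpath_orbit | exact: sv_refl |].
by exists [::], (orbit t x), [::]; rewrite cats0; split => //; right; exists x.
Qed.

Section Detour.
Variables (t : {perm T}) (b x : T).
Hypotheses (bx : ~~ fconnect t b x) (bsx : fconnect t b (s x)).

Definition rest := behead (orbit t x).

(* The edge x is replaced by the other way round the region on its left. *)
Definition detour d := if d == x then pinv rest else if d == s x then rest else [:: d].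

Let xrest : orbit t x = x :: rest.
Proof. by rewrite /rest -orbit_cons. Qed.

Lemma rest_path : vpath s t (s x) rest x.
Proof. by have := vpath_orbit t sK x; rewrite xrest /= sv_refl. Qed.

(** [x :: rest] bounds a 2-cell. For [x], insert [rest ++ pinv rest] behind it and contract the
    2-cell; for [s x], insert the 2-cell behind it and cancel [s x] with [x]. *)
Lemma detour_ph d : path_homotopy t b d (s d) [:: d] (detour d).
Proof.
rewrite /detour; have orb := ph_orbit bx; rewrite xrest in orb.
have [->|dx] := eqVneq d x.
  have h := ph_pinv b rest_path.
  have v1 : vpath s t x [:: x] (s x) by rewrite /= !sv_refl.
  have v2 : vpath s t (s x) [::] (s x) by rewrite /= sv_refl.
  have := ph_ctx h v1 v2; rewrite !cats0 cat1s /= => h1.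
  apply: rst_trans (rst_sym _ _ _ _ h1) _.
  have v0 : vpath s t x [::] x by rewrite /= sv_refl.
  exact: (ph_ctx orb v0 (vpath_pinv rest_path)).
have [->|dsx] := eqVneq d (s x); last exact: rst_refl.
rewrite sK.
have v1 : vpath s t (s x) [:: s x] x by rewrite /= sK !sv_refl.
have v0 : vpath s t x [::] x by rewrite /= sv_refl.
have h1 := ph_ctx orb v1 v0; rewrite !cats0 in h1.
apply: rst_trans (rst_sym _ _ _ _ h1) _.
apply: ph_step; last by exists [::], [:: s x; x], rest; split => //; left; exists (s x); rewrite sK.
  by rewrite (ph_vpath h1).
exact: rest_path.
Qed.

Lemma detour_vpath d : vpath s t d (detour d) (s d).
Proof. by rewrite -(ph_vpath (detour_ph d)) /= !sv_refl. Qed.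

Lemma detour_path y p z : vpath s t y p z ->
  path_homotopy t b y z p (flatten (map detour p)).
Proof.
elim: p y => [|d p IH] y /=; first by move=> _; apply: rst_refl.
move=> /andP[yd dp].
have v0 : vpath s t y [::] d by [].
apply: rst_trans (ph_ctx (detour_ph d) v0 dp) _.
have v1 : vpath s t y (detour d) (s d) by rewrite (vpath_svl _ _ yd) detour_vpath.
have v2 : vpath s t z [::] z by exact: sv_refl.
by have := ph_ctx (IH _ dp) v1 v2; rewrite !cats0.
Qed.

Lemma detour_avoid p d : d \in flatten (map detour p) -> (d != x) && (d != s x).
Proof.
case/flattenP => q /mapP[e _ ->].
have U := orbit_uniq t x; rewrite xrest /= in U; case/andP: U => xr _.
have sxr : s x \notin rest.
  have : s x \notin orbit t x.
    rewrite -fconnect_orbit; apply: contra bx => xsx.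
    by rewrite (same_connect (@pfrel_sym _ t) bsx) pfrel_sym.
  by rewrite xrest inE negb_or => /andP[].
rewrite /detour; case: ifP => [_|/negbT ex].
  rewrite mem_rev => /mapP[f fr ->]; apply/andP; split.
    by apply: contraNneq sxr => <-; rewrite sK.
  by apply: contraNneq xr => /(inv_inj sK) <-.
case: ifP => [_ dr|/negbT esx]; last by rewrite inE => /eqP ->; rewrite ex.
by apply/andP; split; [apply: contraNneq xr | apply: contraNneq sxr] => <-.
Qed.

End Detour.

Lemma slide_vpath t x y p z :
    y != s x -> z != s x -> (forall d, d \in p -> (d != x) && (d != s x)) ->
  vpath s t y p z -> vpath s (slide s t x) y p z.
Proof.
elim: p y => [|d p IH] y yx zx H /=; first exact: slide_sv.
have /andP[dx dsx] := H d (mem_head _ _).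
move=> /andP[/(slide_sv sK yx dsx) -> dp]; apply: IH => //.
  by apply: contra dx => /eqP/(inv_inj sK) ->.
by move=> e ep; apply: H; rewrite inE ep orbT.
Qed.

Lemma slide_vpath_sub t x y p z :
  vpath s (slide s t x) y p z -> vpath s t y p z.
Proof.
elim: p y => [|d p IH] y /=; first exact: slide_sv_sub.
by move=> /andP[/(slide_sv_sub sK) -> /IH].
Qed.

Lemma slide_orbit t b x d : ~~ fconnect t b x -> fconnect t b (s x) ->
  ~~ fconnect (slide s t x) b d -> orbit (slide s t x) d = orbit t d.
Proof.
move=> bx bsx bd.
have nx : ~~ fconnect t x (s x).
  by apply: contra bx => xsx; rewrite (same_connect (@pfrel_sym _ t) bsx) pfrel_sym.
have L := slide_fconnect nx.
have xb : fconnect (slide s t x) x b.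
  have h : fconnect (slide s t x) x (s x).
    by have := fconnect1 (slide s t x) x; rewrite slide_x.
  by apply: connect_trans h _; rewrite pfrel_sym; apply: L.
apply: orbit_tperm; apply: contra bd => dx; rewrite pfrel_sym.
  exact: connect_trans (L _ _ dx) xb.
apply: connect_trans (L _ _ dx) (connect_trans _ xb).
by rewrite pfrel_sym; apply: slide_connect.
Qed.

(** The slide merges one 2-cell into the region of [b]; the 2-cells that remain were already there,
    with the same boundary. *)
Lemma slide_ph t b x y z p q : ~~ fconnect t b x -> fconnect t b (s x) ->
  path_homotopy (slide s t x) b y z p q -> path_homotopy t b y z p q.
Proof.
move=> bx bsx.
have nx : ~~ fconnect t x (s x).
  by apply: contra bx => xsx; rewrite (same_connect (@pfrel_sym _ t) bsx) pfrel_sym.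
elim=> {p q} [p q [xp xq H]|p|p q _ IH|p q r _ IH1 _ IH2].
- apply: ph_step (slide_vpath_sub xp) (slide_vpath_sub xq) _.
  case: H => u [k [v [-> -> H]]]; exists u, k, v; split => //.
  case: H => [|[d bd kd]]; [by left | right]; exists d.
    by apply: contra bd; apply: slide_fconnect.
  by rewrite kd (slide_orbit bx bsx bd).
- exact: rst_refl.
- exact: rst_sym.
- exact: rst_trans IH1 IH2.
Qed.

(** Induction on the number of regions. A path is pushed off an edge [z] between a 2-cell and the
    region of [b]; sliding [z] then absorbs that 2-cell without touching the path. With one region
    left the map is a tree, and backtracks cancel. *)
Theorem map_simply_connected t b : (forall d, s d != d) -> planar s t ->
    (forall x y, hconnect s t x y) ->
  forall x p, vpath s t x p x -> path_homotopy t b x x p [::].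
Proof.
move=> sd; have [n] := ubnP (ncycle t); elim: n t => // n IH t.
rewrite ltnS => tn pl conn x p xp.
have [t1|/(ncycle_gt1 b)[z0 nbz0]] := leqP (ncycle t) 1.
  have {}t1 := ncycle_le1 t1.
  have [m] := ubnP (size p); elim: m p xp => // m IHm p xp; rewrite ltnS => pm.
  case: (altP (p =P [::])) => [->|p0]; first exact: rst_refl.
  have [u [d [v E]]] := tree_backtrack sK pl t1 sd xp p0.
  have st : elem_step t b p (u ++ v).
    by exists u, [:: d; s d], v; split => //; left; exists d.
  have xuv : vpath s t x (u ++ v) x.
    move: xp; rewrite E !(vpath_cat _ _ _ u) => /and3P[-> /= h /andP[_]].
    by rewrite sK (vpath_svl _ _ h).
  apply: rst_trans (ph_step xp xuv st) _; apply: IHm => //.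
  by apply: leq_trans pm; rewrite E !size_cat /=; lia.
have [z bz bsz] := exists_border sK conn nbz0.
have nz : ~~ fconnect t z (s z).
  by apply: contra bz => zsz; rewrite (same_connect (@pfrel_sym _ t) bsz) pfrel_sym.
apply: rst_trans (detour_path bz xp) _.
have xq := xp; rewrite (ph_vpath (detour_path bz xp)) in xq.
have av := @detour_avoid t b z bz bsz p.
case: (flatten _) xq av => [|d q] xq av; first exact: rst_refl.
have /andP[xd dq] := xq.
(* The base dart [x] might be [s z], which the slide moves to another vertex; the first dart [d] of
   the pushed path is not. *)
have {dq}dq : vpath s t d (d :: q) d by rewrite -(vpath_svl _ _ xd) -(vpath_svr _ _ xd).
rewrite sv_sym in xd; apply: ph_sv xd _; apply: slide_ph bz bsz _.
have /andP[_ dsz] := av d (mem_head _ _).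
apply: IH.
- by move: tn; rewrite (slide_ncycle nz).
- exact: slide_planar.
- by move=> u v; apply: slide_hconnect.
- exact: slide_vpath.
Qed.

End Homotopy.

(** * Areas of words *)

Section Area.
Variables (A : finType) (P : word A -> Prop).
Implicit Types (u v w g : word A) (x : letter A).

(** Built up from the empty word, with a cost for each deletion of a word of [P]. Deletion is the
    form that suits diagrams: the boundary segment deleted is closed up into a new region.
    [AreaWeak] makes the index an upper bound. *)
Inductive area : nat -> word A -> Prop :=
| AreaNil : area 0 [::]
| AreaIns n u v x : area n (u ++ v) -> area n (u ++ [:: x; linv x] ++ v)
| AreaDel n u v x : area n (u ++ [:: x; linv x] ++ v) -> area n (u ++ v)
| AreaRel n u r v : P r -> area n (u ++ r ++ v) -> area n.+1 (u ++ v)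
| AreaWeak n w : area n w -> area n.+1 w.

Lemma linvK : involutive (@linv A).
Proof. by case=> a b; rewrite /linv /= negbK. Qed.

Lemma winv_cons x w : winv (x :: w) = winv w ++ [:: linv x].
Proof. by rewrite /winv /= rev_cons cats1. Qed.

Lemma winv_cat u v : winv (u ++ v) = winv v ++ winv u.
Proof. by rewrite /winv map_cat rev_cat. Qed.

Lemma winvK w : winv (winv w) = w.
Proof. by rewrite /winv map_rev revK (mapK linvK). Qed.

Lemma size_winv w : size (winv w) = size w.
Proof. by rewrite /winv size_rev size_map. Qed.

Lemma area_leq n m w : n <= m -> area n w -> area m w.
Proof.
move=> /subnK <- H; elim: (m - n) => // k IH; exact: AreaWeak.
Qed.

Lemma area_insert n m w u v : area n w -> area m (u ++ v) -> area (n + m) (u ++ w ++ v).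
Proof.
move=> + H; elim=> {n w} [|n w1 w2 x _ IH|n w1 w2 x _ IH|n w1 r w2 Pr _ IH|n w _ IH] //.
- have := @AreaIns (n + m) (u ++ w1) (w2 ++ v) x; rewrite -!catA; apply.
  by move: IH; rewrite -!catA.
- have := @AreaDel (n + m) (u ++ w1) (w2 ++ v) x; rewrite -!catA; apply.
  by move: IH; rewrite -!catA.
- have := @AreaRel (n + m) (u ++ w1) r (w2 ++ v) Pr; rewrite -!catA; apply.
  by move: IH; rewrite -!catA.
- exact: AreaWeak.
Qed.

Lemma area_winv_ins n u g v : area n (u ++ v) -> area n (u ++ g ++ winv g ++ v).
Proof.
elim: g u v => [|x g IH] u v //= H.
have := IH (u ++ [:: x]) (linv x :: v); rewrite -!catA winv_cons -!catA; apply.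
exact: AreaIns.
Qed.

Lemma area_winv_del n u g v : area n (u ++ g ++ winv g ++ v) -> area n (u ++ v).
Proof.
elim: g u v => [|x g IH] u v //= H; apply: (@AreaDel _ _ _ x).
have := IH (u ++ [:: x]) (linv x :: v); rewrite -!catA; apply.
by move: H; rewrite winv_cons -!catA.
Qed.

Lemma area_delete n k u w v : area n (u ++ w ++ v) -> area k (winv w) ->
  area (n + k) (u ++ v).
Proof.
rewrite catA addnC => H /area_insert/(_ H); rewrite -catA; exact: area_winv_del.
Qed.

Lemma area_rot n p q : area n (p ++ q) -> area n (q ++ p).
Proof.
move=> H; apply: (@area_winv_del _ [::] (winv p)); rewrite winvK /=.
rewrite -[n]addn0 [p ++ q ++ p]catA; apply: area_insert => //.
by have := @area_winv_ins 0 [::] (winv p) [::] AreaNil; rewrite cats0 winvK.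
Qed.

Lemma area_relator w : P w -> area 1 (winv w).
Proof.
move=> Pw; apply: (@AreaRel 0 [::] w) => //.
by have := @area_winv_ins 0 [::] w [::] AreaNil; rewrite cats0.
Qed.

Lemma area_winv_rot n p q : area n (winv (p ++ q)) -> area n (winv (q ++ p)).
Proof. by rewrite !winv_cat; apply: area_rot. Qed.

(** [p ++ q] labels the region obtained by erasing an edge labelled [x] between two regions.
    Inverses appear because a word of [P] is deleted at cost 1, which bounds the area of its
    inverse. *)
Lemma area_winv_merge n m x p q : area n (winv (x :: p)) ->
  area m (winv (linv x :: q)) -> area (n + m) (winv (p ++ q)).
Proof.
rewrite !winv_cons linvK winv_cat => /area_rot H1 H2.
apply: (@AreaDel _ _ _ x); have := @area_insert _ _ _ [::] _ H2 H1.
by rewrite -!catA addnC.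
Qed.

End Area.

(** * Area of the label of the outer region *)

Section Peel.
Variables (A : finType) (P : word A -> Prop) (T : finType) (s : {perm T}).
Variable lab : T -> letter A.
Hypotheses (sK : involutive s) (sd : forall d, s d != d).
Hypothesis lab_s : forall d, lab (s d) = linv (lab d).
Implicit Types t : {perm T}.

Definition face t d : word A := map lab (orbit t d).

Lemma area_face t n d e : fconnect t d e ->
  area P n (face t d) -> area P n (face t e).
Proof.
by case/orbit_connect => p [q]; rewrite /face => -[-> ->]; rewrite !map_cat; apply: area_rot.
Qed.

Lemma orbit_rcons t x : exists p, orbit t (t x) = rcons p x.
Proof.
have C := fcycle_orbit t x; have E := orbit_cons t x.
case D : (behead (orbit t x)) => [|e q]; rewrite D in E; rewrite E /= in C.
  by exists [::]; move: C; rewrite andbT => /eqP tx; rewrite tx E.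
case/andP: C => /eqP tx _; exists (e :: q); rewrite tx -cats1.
by have := @orbit_rot _ t x [:: x] q e E.
Qed.

(** Read from [t x], the boundary of the left region ends with [x]; the slide sends [x] to [s x],
    where the boundary of the other region begins. *)
Lemma slide_face t x : ~~ fconnect t x (s x) ->
  orbit (slide s t x) (t x) = orbit t (t x) ++ orbit t (s x).
Proof.
move=> nx; set y := t^-1%g (s x).
have ty : t y = s x by rewrite permKV.
have [p Ep] := orbit_rcons t x; have [q Eq] := orbit_rcons t y; rewrite ty in Eq.
have U : uniq (orbit t (t x) ++ orbit t (s x)).
  rewrite cat_uniq !orbit_uniq /= andbT; apply/hasPn => z.
  rewrite -!fconnect_orbit => zs; apply: contra nx => zx.
  rewrite (same_fconnect1 (@perm_inj _ t)).
  by apply: connect_trans zx _; rewrite pfrel_sym.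
have Cp := fcycle_orbit t (t x); have Cq := fcycle_orbit t (s x).
rewrite Ep Eq in U Cp Cq *.
have [C _] := orbit_merge Cp Cq U; rewrite -/(slide s t x) in C.
have H : head x (rcons p x) = t x by rewrite -Ep orbit_cons.
case: p {Ep Cp} U C H => [|z p] U C /= H; rewrite -H; exact: orbit_fcycle.
Qed.

Lemma area_tree t x p : planar s t -> ncycle t <= 1 -> vpath s t x p x ->
  area P 0 (map lab p).
Proof.
move=> pl /ncycle_le1 t1; have [m] := ubnP (size p).
elim: m p => // m IHm p; rewrite ltnS => pm xp.
case: (altP (p =P [::])) => [->|p0]; first exact: AreaNil.
have [u [d [v E]]] := tree_backtrack sK pl t1 sd xp p0.
rewrite E !map_cat /= lab_s; apply: AreaIns; rewrite -map_cat; apply: IHm.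
  by apply: leq_trans pm; rewrite E !size_cat /=; lia.
move: xp; rewrite E !(vpath_cat _ _ _ u) => /and3P[-> /= h /andP[_]].
by rewrite sK (vpath_svl _ _ h).
Qed.

(* Merge the regions one by one with the outer one, until a tree remains. *)
Lemma area_outer_face t b K : planar s t -> (forall x y, hconnect s t x y) ->
    (forall z, ~~ fconnect t b z -> area P K (winv (face t z))) ->
  area P ((ncycle t).-1 * K) (face t b).
Proof.
have [n] := ubnP (ncycle t); elim: n t => // n IH t.
rewrite ltnS => tn pl conn H.
have [t1|/(ncycle_gt1 b)[z0 nbz0]] := leqP (ncycle t) 1.
  apply: area_leq (area_tree pl t1 (vpath_orbit t sK b)); lia.
have [x bx bsx] := exists_border sK conn nbz0.
have nx : ~~ fconnect t x (s x).
  by apply: contra bx => xsx; rewrite (same_connect (@pfrel_sym _ t) bsx) pfrel_sym.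
have L := slide_fconnect nx; have N := slide_ncycle nx.
have {}IH : area P ((ncycle (slide s t x)).-1 * K) (face (slide s t x) b).
  apply: IH.
  - by rewrite -N.
  - exact: slide_planar.
  - by move=> u v; apply: slide_hconnect.
  - move=> z bz; rewrite /face (slide_orbit bx bsx bz); apply: H.
    by apply: contra bz; apply: L.
have btx : fconnect (slide s t x) b (t x).
  apply: connect_trans (L _ _ bsx) _; rewrite -(slide_x s t x).
  apply: connect_trans (_ : fconnect _ _ x) (L _ _ (fconnect1 _ _)).
  by rewrite pfrel_sym fconnect1.
(* The new outer label is that of the absorbed region followed by the old outer one; deleting the
   former costs [K]. *)
have := area_face btx IH; rewrite /face slide_face // map_cat => H1.
have Htx : area P K (winv (face t (t x))).
  by apply: H; rewrite -(same_fconnect1_r (@perm_inj _ t)).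
have := @area_delete _ _ _ _ [::] _ _ H1 Htx => /= H2.
have bsx' : fconnect t (s x) b by rewrite pfrel_sym.
apply: area_leq (area_face bsx' H2); have := ncycle_gt0 (slide s t x) b.
by rewrite N; case: (ncycle _) => //= k _; rewrite mulSn; lia.
Qed.

End Peel.

(** * Counting regions *)

Section Component.
Variable T : finType.
Implicit Types (s t r : {perm T}).

(** The component of [b] as a map of its own. [comp_count] keeps track of the cycles lost with the
    other components, for any permutation that [h] respects, such as [t] or [s * t]. *)
Record component s t b (U : finType) (h : U -> T) (s' t' : {perm U}) (b' : U) : Prop :=
  Component {
    comp_inj : injective h;
    comp_base : h b' = b;
    comp_l : forall u, s (h u) = h (s' u);
    comp_r : forall u, t (h u) = h (t' u);
    comp_planar : planar s t -> planar s' t';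
    comp_conn : forall u v, hconnect s' t' u v;
    comp_codom : forall x, (x \in codom h) = hconnect s t b x;
    comp_count : forall r (r' : {perm U}), (forall u, r (h u) = h (r' u)) ->
      ncycle r = ncycle r' + fcard r [predC (hconnect s t b)]
  }.

Lemma exists_component s t b : exists (U : finType) (h : U -> T) (s' t' : {perm U}) (b' : U),
  component s t b h s' t' b'.
Proof.
pose S := [pred x | hconnect s t b x].
have cl : closed (hrel s t) S.
  by move=> x y xy; rewrite !inE; apply: (connect_closed (@hrel_sym _ s t) b xy).
have cls : fclosed s S by move=> x y /eqP E; apply: cl; rewrite /hrel /= E eqxx.
have clt : fclosed t S by move=> x y /eqP E; apply: cl; rewrite /hrel /= E eqxx orbT.
have [s' hs] := restrict_perm cls; have [t' ht] := restrict_perm clt.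
have Sb : b \in S by rewrite inE connect0.
exists {x | x \in S}, val, s', t', (exist _ b Sb).
have cod x : (x \in codom (fun u : {x | x \in S} => val u)) = hconnect s t b x.
  by rewrite codom_sig inE.
split => //.
- exact: val_inj.
- exact: planar_restrict.
- move=> u v.
  have adj : rel_adjunction (fun u : {x | x \in S} => val u) (hrel s t) (hrel s' t') S.
    apply: strict_adjunction => //.
    + exact: hrel_sym.
    + exact: val_inj.
    + by apply/subsetP => x; rewrite codom_sig.
    + by move=> x y _; rewrite /hrel /= hs ht !(inj_eq val_inj).
  rewrite (rel_functor adj _ (valP u)).
  have bu : hconnect s t b (val u) := valP u.
  have bv : hconnect s t b (val v) := valP v.
  by apply: connect_trans bv; rewrite hrel_sym.
- move=> r r' hr; rewrite {1}/ncycle (n_compC S) (ncycle_restrict hr).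
  by congr (_ + _); apply: eq_n_comp_r.
Qed.

Lemma component_face (A : finType) (lab : T -> letter A) s t b (U : finType) h
    (s' t' : {perm U}) b' u : component s t b h s' t' b' ->
  face (lab \o h) t' u = face lab t (h u).
Proof.
by move=> C; rewrite /face (orbit_val _ (comp_inj C) (comp_r C)) map_comp.
Qed.

Lemma card_closed t (a : {pred T}) : fclosed t a ->
  #|a| = \sum_(r | froots t r && (r \in a)) order t r.
Proof.
move=> cl; rewrite -sum1_card (partition_big (froot t) [pred r | froots t r && (r \in a)]) /=.
  apply: eq_bigr => r /andP[/eqP rr ra]; rewrite sum1_card; apply: eq_card => x.
  rewrite !inE /= -(root_connect (@pfrel_sym _ t)) rr [RHS]eq_sym unfold_in.
  case: eqP => [E|]; last by rewrite andbF.
  by rewrite andbT (closed_connect cl (connect_root (frel t) x)) E.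
move=> x xa; rewrite (roots_root (@pfrel_sym _ t)) /=.
by rewrite -(closed_connect cl (connect_root _ x)).
Qed.

Lemma card_invol s : involutive s -> (forall d, s d != d) -> #|T| = 2 * ncycle s.
Proof.
move=> sK sd; rewrite /ncycle mulnC (fcard_order_set (@perm_inj _ s)) //.
apply/subsetP => d _; rewrite inE.
have C : fcycle s [:: d; s d] by rewrite /= sK !eqxx.
by rewrite (order_cycle C) ?mem_head //= inE eq_sym sd.
Qed.

Lemma ncomp_conn s t : (forall x y, hconnect s t x y) -> T -> ncomp s t = 1.
Proof.
move=> conn b; rewrite -(n_comp_connect (@hrel_sym _ s t) b).
by apply: eq_n_comp_r => x; rewrite !inE conn.
Qed.

Lemma euler s t : involutive s -> (forall d, s d != d) -> planar s t ->
    (forall x y, hconnect s t x y) -> T ->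
  ncycle (s * t)%g + ncycle t = ncycle s + 2.
Proof.
move=> sK sd /eqP + conn b; rewrite (ncomp_conn conn b) (card_invol sK sd); lia.
Qed.

(* If no region with at most two sides borders another inner region, the small
   regions border the outer one, and Euler's formula bounds the other ones. *)
Lemma few_faces s t b : involutive s -> (forall d, s d != d) -> planar s t ->
    (forall x y, hconnect s t x y) ->
    (forall d, ~~ fconnect t b d -> order t d <= 2 -> ~~ fconnect t d (s d) ->
       fconnect t b (s d)) ->
  (ncycle t).-1 <= 3 * (ncycle (s * t)%g + order t b).
Proof.
move=> sK sd pl conn H; have E := euler sK sd pl conn b.
have V := ncycle_gt0 (s * t)%g b.
pose inner := [pred r | froots t r && ~~ fconnect t b r].
pose small := [pred r | inner r & order t r <= 2].
pose big := [pred r | inner r & 2 < order t r].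
have cl : fclosed t T by [].
have F : ncycle t = 1 + (#|small| + #|big|).
  rewrite {1}/ncycle (n_compC (fconnect t b)) (n_comp_connect (@pfrel_sym _ t)); congr (_ + _).
  rewrite /n_comp_mem -(cardID [pred r | order t r <= 2]); congr (_ + _);
    by apply: eq_card => r; rewrite !inE /= -?ltnNge // andbC.
have B : 3 * #|big| <= #|T|.
  rewrite (card_closed cl) (bigID [pred r | big r]) /= mulnC -sum_nat_const.
  apply: leq_trans (leq_addr _ _).
  rewrite [X in _ <= X](eq_bigl big); last first.
    by move=> r; rewrite !inE /= andbT; case: (froots t r).
  by apply: leq_sum => r /andP[].
have S : #|small| <= order t b.
  (* [g r] is a side of the region of [r] facing the outer region, so that [s \o g] injects the
     small regions into the outer boundary. By [gP] the default is never taken for a small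
     region. *)
  pose g (r : T) := odflt r [pick d | fconnect t r d && fconnect t b (s d)].
  have gP (r : T) : r \in small -> fconnect t r (g r) && fconnect t b (s (g r)).
    rewrite !inE => /andP[/andP[_ br] sr]; rewrite /g; case: pickP => //= N.
    (* Without such a side the region of [r] would be closed under [s] and [t], hence be the whole
       map and contain [b]. *)
    have cr : closed (hrel s t) (fconnect t r).
      apply: intro_closed (@hrel_sym _ s t) _ _ => u v uv ru.
      have {}ru : fconnect t r u := ru.
      case/orP: uv => /eqP <-; last by apply: connect_trans ru (fconnect1 _ _).
      have bu : ~~ fconnect t b u.
        by apply: contra br => bu; apply: connect_trans bu _; rewrite pfrel_sym.
      have ou : order t u <= 2.
        rewrite /order (eq_card (B := fconnect t r)) // => x.
        by rewrite /in_mem /= (same_connect (@pfrel_sym _ t) ru).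
      have := N u; rewrite /= ru /= => nbu.
      case: (boolP (fconnect t u (s u))) => [uu|nuu].
        exact: connect_trans ru uu.
      by rewrite (H u bu ou nuu) in nbu.
    have := closed_connect cr (conn r b); rewrite !inE connect0 => /esym rb.
    by rewrite pfrel_sym rb in br.
  rewrite -(card_in_image (f := s \o g) (A := small)).
    apply: subset_leq_card; apply/subsetP => x /imageP[r /gP/andP[_ br] ->].
    exact: br.
  move=> r r' rs rs' /= /perm_inj E'.
  have /andP[h _] := gP _ rs; have /andP[h' _] := gP _ rs'; rewrite E' in h.
  move: rs rs'; rewrite !inE => /andP[/andP[/eqP <- _] _] /andP[/andP[/eqP <- _] _].
  apply/(rootP (@pfrel_sym _ t)); apply: connect_trans h _.
  by rewrite pfrel_sym.
(* With V, E, F for vertices, edges, regions: [V + F = E + 2], [F = 1 + #|small| + #|big|] and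
   [3 * #|big| <= 2 * E] give [#|big| + 2 <= 2 * V + 2 * #|small|], so that [F - 1] is at most
   [2 * V + 3 * #|small|]. *)
have C := card_invol sK sd; lia.
Qed.

End Component.

Lemma exists_rcons (T : eqType) (p : seq T) : p != [::] -> exists q x, p = rcons q x.
Proof. by case/lastP: p => // q x _; exists q, x. Qed.

(** * Erasing an edge between two regions *)

Section Delete.
Variables (T : finType) (s : {perm T}).
Hypothesis sK : involutive s.
Implicit Types t : {perm T}.

(* Removing the edge e between two regions leaves it as a separate component,
   which the later restriction to the component of the boundary drops. *)
Lemma delete_edge t e q1 q2 : planar s t -> ~~ fconnect t e (s e) ->
    orbit t e = e :: q1 -> orbit t (s e) = s e :: q2 -> q1 ++ q2 != [::] ->
  exists t', [/\ planar s t', ncycle (s * t')%g <= ncycle (s * t)%g + 2,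
    t' e = s e, t' (s e) = e &
    fcycle t' (q1 ++ q2) /\
    forall d, ~~ fconnect t d e -> ~~ fconnect t d (s e) -> orbit t' d = orbit t d].
Proof.
move=> pl ne E1 E2 q0.
(* [w] precedes [e]: exchanging the successors of [w] and [s e] merges the two regions into the
   cycle [e :: q1 ++ q2 ++ [:: s e]]. *)
have [p [w Ep]] : exists p w, e :: q1 = rcons p w by apply: exists_rcons.
have [r [z Er]] := exists_rcons q0.
have C1 : fcycle t (rcons p w) by rewrite -Ep -E1 fcycle_orbit.
have C2 : fcycle t (rcons q2 (s e)).
  by rewrite -rot1_cons rot_cycle -E2 fcycle_orbit.
have U : uniq (rcons p w ++ rcons q2 (s e)).
  rewrite -Ep -cats1 cat_uniq -E1 orbit_uniq /=.
  have U2 := orbit_uniq t (s e); rewrite E2 -cat1s uniq_catC in U2; rewrite U2 andbT.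
  apply/hasPn => x; rewrite mem_cat orbC -mem_cat /= -E2 -!fconnect_orbit => sx.
  apply: contra ne => ex; apply: connect_trans ex _; by rewrite pfrel_sym.
have [Ct Ot] := orbit_merge C1 C2 U.
have sV := invol_inv sK.
have se_w : fconnect (s * t)%g (s w) e.
  have := fconnect1 (s * t)%g (s w); rewrite permM sK.
  by move: C1; rewrite fcycle_rcons -Ep /= => /andP[/eqP -> _].
have wse : w != s e.
  apply: contra ne => /eqP <-; rewrite fconnect_orbit E1 Ep mem_rcons mem_head //.
set t1 := (tperm w (s e) * t)%g in Ct Ot.
have pl1 : planar s t1.
  by apply: planar_tperm => //; apply/or3P; apply: Or33; rewrite sV sK.
have V1 : ncycle (s * t1)%g = (ncycle (s * t)%g).+1.
  rewrite /t1 tperm_mull sV sK; apply: ncycle_tperm_split => //.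
  by apply: contra wse => /eqP <-; rewrite sK.
(* In the merged cycle [s e] is followed by [e]; a second transposition cuts off this pair and
   leaves [q1 ++ q2]. *)
have R : rcons p w ++ rcons q2 (s e) = e :: rcons r z ++ [:: s e].
  by rewrite -Ep -Er -cats1 /= !catA.
have R' : rcons r z ++ rcons [:: s e] e = rot 1 (rcons p w ++ rcons q2 (s e)).
  by rewrite R rot1_cons -[rcons (_ ++ _) e]cats1 -catA.
have C : fcycle t1 (rcons r z ++ rcons [:: s e] e) by rewrite R' rot_cycle.
have U' : uniq (rcons r z ++ rcons [:: s e] e) by rewrite R' rot_uniq.
have [Cr Ce Or] := orbit_split C U'.
set t2 := (tperm z e * t1)%g in Cr Ce Or.
exists t2; have /and3P[/eqP t2se /eqP t2e _] := Ce; split => //; last split.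
- apply: planar_tperm => //; apply/or3P; apply: Or32.
  by rewrite (fconnect_cycle C) // mem_cat ?mem_rcons !inE eqxx ?orbT.
- by rewrite /t2 tperm_mull addn2 -V1; apply: ncycle_tperm_le.
- by rewrite Er.
move=> d de dse.
have nd : d \notin rcons p w ++ rcons q2 (s e).
  rewrite mem_cat [_ \in rcons q2 _]mem_rcons -Ep -E1 -E2 -!fconnect_orbit.
  by rewrite !(pfrel_sym _ _ d) negb_or de.
by rewrite Or; [apply: Ot | rewrite R' mem_rot].
Qed.

End Delete.

Section SmallFaces.
Variables (A : finType) (P : word A -> Prop) (K M : nat).
Hypothesis KP : forall w, size w <= M -> (exists m, area P m (winv w)) ->
  area P K (winv w).

(* Erasing edges keeps the vertices and the boundary, so that the number of
   regions can be bounded in terms of these alone; each of the new regions is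
   then filled at cost K. *)
Lemma area_of_vertices (T : finType) (s t : {perm T}) (lab : T -> letter A) b :
    involutive s -> (forall d, s d != d) -> (forall d, lab (s d) = linv (lab d)) ->
    planar s t -> (forall x y, hconnect s t x y) ->
    (forall z, ~~ fconnect t b z -> order t z <= M /\
       exists m, area P m (winv (face lab t z))) ->
  area P (3 * (ncycle (s * t)%g + order t b) * K) (face lab t b).
Proof.
have [n] := ubnP #|T|; elim: n T s t lab b => // n IH T s t lab b.
rewrite ltnS => Tn sK sd ls pl conn H.
case: (pickP [pred d | [&& ~~ fconnect t b d, ~~ fconnect t b (s d),
    ~~ fconnect t d (s d) & order t d <= 2]]) => [e /= |N]; last first.
  apply: area_leq (area_outer_face sK sd ls pl conn (K := K) _); last first.
    by move=> z bz; apply: KP; have [? ?] := H z bz; rewrite // size_map size_orbit.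
  rewrite leq_mul2r (few_faces sK sd pl conn) ?orbT // => d bd od dsd.
  by have := N d; rewrite /= bd od dsd /= andbT => /negbFE.
case/and4P => be bse ese oe.
set q1 := behead (orbit t e); have E1 : orbit t e = e :: q1 by exact: orbit_cons.
set q2 := behead (orbit t (s e)); have E2 : orbit t (s e) = s e :: q2 by exact: orbit_cons.
(* Otherwise [e] and [s e] would each be a one-sided region and form the whole connected map, which
   contains [b]. *)
have q0 : q1 ++ q2 != [::].
  apply/negP => /eqP q0.
  have te : t e = e.
    by have := fcycle_orbit t e; rewrite E1; case: (q1) q0 => // _ /=; rewrite andbT => /eqP.
  have tse : t (s e) = s e.
    have := fcycle_orbit t (s e); rewrite E2; case: (q2) q0 => [_|? ?] /=.
      by rewrite andbT => /eqP.
    by case: (q1).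
  have cl : closed (hrel s t) (pred2 e (s e)).
    apply: intro_closed (@hrel_sym _ s t) _ _ => u v /orP[] /eqP <-;
    by rewrite !inE => /orP[] /eqP->; rewrite ?sK ?te ?tse eqxx ?orbT.
  have := closed_connect cl (conn e b); rewrite !inE eqxx /= => /esym/orP[] /eqP E;
  by move: be bse; rewrite E connect0.
have [t' [pl' V' t'e t'se [C' O']]] := delete_edge sK pl ese E1 E2 q0.
have [U [h [s1 [t1 [b1 C]]]]] := exists_component s t' b.
have hb := comp_base C; have hs := comp_l C; have ht := comp_r C; have hi := comp_inj C.
have Ob : orbit t' b = orbit t b by apply: O'.
have cl : closed (hrel s t') (pred2 e (s e)).
  apply: intro_closed (@hrel_sym _ s t') _ _ => u v /orP[] /eqP <-;
  by rewrite !inE => /orP[] /eqP->; rewrite ?sK ?t'e ?t'se eqxx ?orbT.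
have nb : (b \in pred2 e (s e)) = false.
  apply/negbTE; rewrite !inE negb_or.
  by apply/andP; split; [apply: contraNneq be | apply: contraNneq bse] => <-; apply: connect0.
have nh u : h u \notin pred2 e (s e).
  have : h u \in codom h by apply: codom_f.
  by rewrite (comp_codom C) => /(closed_connect cl) <-; rewrite nb.
have ne : ~~ hconnect s t' b e.
  by apply/negP => /(closed_connect cl); rewrite nb !inE eqxx.
have nse : ~~ hconnect s t' b (s e).
  by apply/negP => /(closed_connect cl); rewrite nb !inE eqxx orbT.
(* The two vertices that [delete_edge] may add are made up for by the ends of the isolated edge,
   which lie outside the component of [b]. *)
have V1 : ncycle (s1 * t1)%g <= ncycle (s * t)%g.
  rewrite -(leq_add2r 2); apply: leq_trans V'.
  have hst u : (s * t')%g (h u) = h ((s1 * t1)%g u) by rewrite !permM hs ht.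
  rewrite (comp_count C hst) leq_add2l.
  apply/fcard_gt1P; first exact: perm_inj.
    apply: predC_closed => x y /eqP <-.
    by apply: (closed_connect (connect_closed (@hrel_sym _ s t') b)); apply: fconnect_m; apply: fconnect1.
  exists e; first exact: ne.
  exists (s e); first exact: nse.
  have fe : (s * t')%g e = e by rewrite permM t'se.
  have C1 : fcycle (s * t')%g [:: e] by rewrite /= fe eqxx.
  by rewrite (fconnect_cycle C1) ?inE // sd.
have ob : order t1 b1 = order t b.
  by rewrite -!size_orbit -Ob -hb (orbit_val _ hi ht) size_map.
have fb : face (lab \o h) t1 b1 = face lab t b.
  by rewrite (component_face _ _ C) hb /face Ob.
rewrite -fb -ob; apply: (@area_leq _ _ (3 * (ncycle (s1 * t1)%g + order t1 b1) * K)).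
  by rewrite leq_mul2r leq_mul2l leq_add2r V1 !orbT.
apply: IH.
- apply: leq_trans Tn; rewrite -(card_codom hi); apply: proper_card.
  apply/properP; split; first by apply/subsetP.
  by exists e; rewrite // (comp_codom C).
- by move=> u; apply: hi; rewrite -!hs sK.
- by move=> u; rewrite -(inj_eq hi) -hs sd.
- by move=> u; rewrite /= -hs ls.
- exact: comp_planar C pl'.
- exact: comp_conn C.
move=> u nbu; rewrite (component_face _ _ C) -size_orbit -(size_map h) -(orbit_val _ hi ht).
have {nbu}nbu : ~~ fconnect t' b (h u) by rewrite -hb (fconnect_val _ _ hi ht).
have nbu' : ~~ fconnect t b (h u) by rewrite fconnect_orbit -Ob -fconnect_orbit.
have [se1 [m1 a1]] := H e be; have [se2 [m2 a2]] := H _ bse.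
have cyc z : z \in q1 ++ q2 -> exists p q, orbit t' z = p ++ q /\ q1 ++ q2 = q ++ p.
  move=> zq.
  have U' : uniq (q1 ++ q2).
    have := orbit_uniq t e; have := orbit_uniq t (s e).
    rewrite E1 E2 /= cat_uniq => /andP[_ ->] /andP[_ ->]; rewrite andbT /=.
    apply/hasPn => x xq2; apply: contra ese => xq1.
    have ex : fconnect t e x by rewrite fconnect_orbit E1 inE xq1 orbT.
    have sx : fconnect t (s e) x by rewrite fconnect_orbit E2 inE xq2 orbT.
    by apply: connect_trans ex _; rewrite pfrel_sym.
  rewrite (orbitE C' U' zq) /rot.
  by exists (drop (index z (q1 ++ q2)) (q1 ++ q2)), (take (index z (q1 ++ q2)) (q1 ++ q2)); rewrite cat_take_drop.
case: (boolP (h u \in q1 ++ q2)) => [/cyc[p [q [E Eq]]]|nq].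
  rewrite /face E; split.
    (* [q1] has at most one dart, as the region of [e] has at most two sides, and [q2] lacks the
       dart [s e]: at most [M] in all. *)
    rewrite size_cat addnC -size_cat -Eq size_cat.
    move: oe se2; rewrite -!size_orbit E1 E2 /= ltnS => oe se2.
    exact: leq_trans (leq_add oe (leqnn _)) se2.
  exists (m1 + m2); rewrite map_cat; apply: area_winv_rot; rewrite -map_cat -Eq map_cat.
  apply: (@area_winv_merge _ _ _ _ (lab e)); first by rewrite /face E1 in a1.
  by rewrite /face E2 /= ls in a2.
have Oh : orbit t' (h u) = orbit t (h u).
  have := nh u; rewrite !inE negb_or => /andP[hue huse].
  rewrite mem_cat negb_or in nq; case/andP: nq => nq1 nq2.
  by apply: O'; rewrite pfrel_sym fconnect_orbit ?E1 ?E2 inE negb_or ?hue ?huse.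
by rewrite /face Oh size_orbit; apply: H.
Qed.

End SmallFaces.

(** * Diagrams from areas *)

Section Disk.
Variables (A : finType) (P : word A -> Prop).
Hypothesis Prot : forall p q, P (p ++ q) -> P (q ++ p).

Definition labelled (T : finType) (s : {perm T}) (lab : T -> letter A) : Prop :=
  [/\ involutive s, forall d, s d != d & forall d, lab (s d) = linv (lab d)].

(* The bound n.+1 also counts the outer region, that of b. *)
Definition disk n (W : word A) : Prop :=
  exists (T : finType) (s t : {perm T}) (lab : T -> letter A) (b : T),
  [/\ labelled s lab, planar s t, forall x y, hconnect s t x y,
      face lab t b = W /\ forall z, ~~ fconnect t b z -> P (face lab t z) &
      ncycle t <= n.+1].

(** Surgery may cut off parts of the map. Only the component of [b] is kept, so conditions on
    regions are required there alone and the regions outside are not counted. *)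
Lemma disk_component n W (T : finType) (s t : {perm T}) lab b :
    labelled s lab -> planar s t -> face lab t b = W ->
    (forall z, hconnect s t b z -> ~~ fconnect t b z -> P (face lab t z)) ->
    ncycle t <= n.+1 + fcard t [predC (hconnect s t b)] ->
  disk n W.
Proof.
move=> [sK sd ls] pl fW fP ct.
have [U [h [s1 [t1 [b1 C]]]]] := exists_component s t b.
have hb := comp_base C; have hs := comp_l C; have ht := comp_r C; have hi := comp_inj C.
exists U, s1, t1, (lab \o h), b1; split.
- split=> [u|u|u]; first by apply: hi; rewrite -!hs sK.
    by rewrite -(inj_eq hi) -hs sd.
  by rewrite /= -hs ls.
- exact: comp_planar C pl.
- exact: comp_conn C.
- split=> [|z]; first by rewrite (component_face _ _ C) hb.
  rewrite (component_face _ _ C) -(fconnect_val _ _ hi ht) hb; apply: fP.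
  by rewrite -(comp_codom C) codom_f.
- by move: ct; rewrite (comp_count C ht) leq_add2r.
Qed.

Lemma disk_leq n m W : n <= m -> disk n W -> disk m W.
Proof.
move=> nm [T [s [t [lab [b [H1 H2 H3 H4 H5]]]]]].
by exists T, s, t, lab, b; split => //; apply: leq_trans H5 _.
Qed.

Lemma disk_rot n p q : disk n (p ++ q) -> disk n (q ++ p).
Proof.
case: q => [|x q]; first by rewrite cats0.
move=> [T [s [t [lab [b [H1 H2 H3 [H4 H4'] H5]]]]]].
have := congr1 (drop (size p)) H4; rewrite drop_size_cat // -map_drop.
have := congr1 (take (size p)) H4; rewrite take_size_cat // -map_take.
case E : (drop (size p) (orbit t b)) => [|d r] //= E1 [E2 E3].
have O : orbit t b = take (size p) (orbit t b) ++ d :: r by rewrite -E cat_take_drop.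
have bd : fconnect t b d by rewrite fconnect_orbit O mem_cat mem_head orbT.
exists T, s, t, lab, d; split => //; split.
  by rewrite /face (orbit_rot O) /= map_cat E1 E2 E3.
by move=> z dz; apply: H4'; rewrite (same_connect (@pfrel_sym _ t) bd).
Qed.

(** Taken for both permutations, it is the map of a single edge: two vertices and one two-sided
    region. *)
Definition bool_swap : {perm bool} := perm (inv_inj negbK).

Lemma bool_swapE b : bool_swap b = ~~ b.
Proof. by rewrite permE. Qed.

Lemma bool_swap_ncycle : ncycle bool_swap = 1.
Proof.
rewrite -(n_comp_connect (@pfrel_sym _ bool_swap) true).
apply: eq_n_comp_r => -[]; rewrite !inE ?connect0 //.
by have := fconnect1 bool_swap true; rewrite bool_swapE.
Qed.

Lemma bool_swap_planar : planar bool_swap bool_swap.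
Proof.
rewrite /planar; have -> : (bool_swap * bool_swap)%g = 1%g.
  by apply/perm.permP => b; rewrite permM perm1 !bool_swapE negbK.
have -> : ncomp bool_swap bool_swap = 1.
  rewrite -bool_swap_ncycle; apply: eq_n_comp => x y; apply/idP/idP; last exact: fconnect_l.
  by apply: hconnect_sub => z; apply: fconnect1.
by rewrite ncycle1 bool_swap_ncycle card_bool.
Qed.

Lemma disk_pair x : disk 0 [:: x; linv x].
Proof.
have C : fcycle bool_swap [:: false; true] by rewrite /= !bool_swapE.
exists bool, bool_swap, bool_swap, (fun b : bool => if b then linv x else x), false; split.
- split=> [b|b|b]; rewrite ?bool_swapE ?negbK //; first by case: b.
  by case: b => //=; rewrite linvK.
- exact: bool_swap_planar.
- by move=> b c; apply: fconnect_l; rewrite (fconnect_cycle C) //; [case: c | case: b].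
- split; first by rewrite /face (orbit_fcycle C).
  by move=> z; rewrite (fconnect_cycle C) // !inE; case: z.
- by rewrite bool_swap_ncycle.
Qed.

Definition addp (T : finType) (s : {perm T}) (x : T + bool) : T + bool :=
  match x with inl u => inl (s u) | inr b => inr (bool_swap b) end.

Lemma addp_inj (T : finType) (s : {perm T}) : injective (addp s).
Proof. by move=> [u|b] [v|c] //= [/perm_inj ->]. Qed.

Lemma disk_pendant n W x : disk n W -> disk n (W ++ [:: x; linv x]).
Proof.
move=> [T [s [t [lab [b [[sK sd ls] pl conn [fW fP] ct]]]]]].
pose s' : {perm T + bool} := perm (@addp_inj T s).
pose t0 : {perm T + bool} := perm (@addp_inj T t).
have s1 u : s' (inl u) = inl (s u) by rewrite permE.
have s2 c : s' (inr c) = inr (bool_swap c) by rewrite permE.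
have t1 u : t0 (inl u) = inl (t u) by rewrite permE.
have t2 c : t0 (inr c) = inr (bool_swap c) by rewrite permE.
have inlI : injective (@inl T bool) by move=> ? ? [].
have inrI : injective (@inr T bool) by move=> ? ? [].
have cod (z : T + bool) : (z \in codom (@inl T bool)) = (z \notin codom (@inr T bool)).
  case: z => [u|c].
    by rewrite codom_f; apply/esym/negP => /codomP[].
  by rewrite codom_f; apply/negP => /codomP[].
have pl0 : planar s' t0.
  by rewrite (planar_glueE inlI inrI cod s1 t1 s2 t2) pl bool_swap_planar.
have ct0 : ncycle t0 = (ncycle t).+1.
  by rewrite (ncycle_glue inlI inrI cod t1 t2) bool_swap_ncycle addn1.
have [p [y E]] : exists p y, orbit t b = rcons p y.
  by apply: exists_rcons; rewrite orbit_cons.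
have C1 : fcycle t0 (rcons (map inl p) (inl y)).
  by rewrite -map_rcons -E -(orbit_val _ inlI t1) fcycle_orbit.
have C2 : fcycle t0 (rcons [:: inr false] (inr true)).
  by rewrite /= !t2 !bool_swapE !eqxx.
have U : uniq (rcons (map inl p) (inl y) ++ rcons [:: inr false] (inr true : T + bool)).
  rewrite cat_uniq -map_rcons -E (map_inj_uniq inlI) orbit_uniq /= andbT orbF !negb_or.
  by apply/andP; split; apply/negP => /mapP[].
have [Ct Ot] := orbit_merge C1 C2 U.
set t' := (tperm _ _ * t0)%g in Ct Ot.
(* The new edge is still a separate component, so attaching it preserves planarity and merges its
   only region with the outer one. *)
have nh : ~~ hconnect s' t0 (inl y) (inr true).
  have cl : closed (hrel s' t0) [in codom (@inl T bool)].
    by move=> u v /orP[]; [apply: closed_codom s1 _ _ | apply: closed_codom t1 _ _].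
  apply/negP => /(closed_connect cl).
  have -> : inl y \in [in codom (@inl T bool)] by exact: codom_f.
  by move/esym/codomP => [].
have ct' : (ncycle t').+1 = ncycle t0.
  have := ncycle_tperm t0 (inl y) (inr true).
  by rewrite (negbTE (contra (@fconnect_r _ s' t0 _ _) nh)) -/t' /=; lia.
pose lab' (z : T + bool) := match z with
  inl u => lab u | inr c => if c then linv x else x end.
have Ob : orbit t' (inl b) = map inl (orbit t b) ++ [:: inr false; inr true].
  have Eb : rcons p y = b :: behead (orbit t b) by rewrite -E -orbit_cons.
  have R : rcons (map inl p) (inl y) ++ rcons [:: inr false] (inr true)
     = inl b :: map inl (behead (orbit t b)) ++ [:: inr false; inr true] :> seq (T + bool).
    by rewrite -map_rcons Eb.
  rewrite R in Ct U; rewrite (orbit_fcycle Ct U) E Eb //.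
apply: (@disk_component n _ _ s' t' lab' (inl b)).
- split=> [[u|c]|[u|c]|[u|c]]; rewrite ?s1 ?s2 ?sK ?bool_swapE ?negbK //.
  + by rewrite (inj_eq inlI).
  + by case: c.
  + exact: ls.
  + by case: c => /=; rewrite ?linvK.
- by apply: planar_tperm => //; rewrite nh.
- rewrite /face Ob map_cat -map_comp -fW; congr (_ ++ _).
- move=> z _; rewrite fconnect_orbit Ob mem_cat negb_or => /andP[].
  case: z => [u|[]]; rewrite ?inE ?eqxx ?orbT //= (mem_map inlI) => nu _.
  rewrite /face Ot; last first.
    rewrite -map_rcons -E mem_cat (mem_map inlI) negb_or nu !inE //.
  rewrite (orbit_val _ inlI t1) -map_comp; apply: fP; by rewrite fconnect_orbit.
- by apply: leq_trans (leq_addr _ _); rewrite -ltnS ct' ct0.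
Qed.

Lemma orbit_face (T : finType) (t : {perm T}) (lab : T -> letter A) b p q :
  face lab t b = p ++ q -> exists p' q',
    [/\ orbit t b = p' ++ q', map lab p' = p & map lab q' = q].
Proof.
move=> H; exists (take (size p) (orbit t b)), (drop (size p) (orbit t b)).
by rewrite cat_take_drop map_take map_drop -/(face lab t b) H take_size_cat // drop_size_cat.
Qed.

(** The outer region is pinched between the last darts of [p] and [q]; as both lie on one region, no
    handle arises. *)
Lemma split_boundary (T : finType) (s t : {perm T}) b p q : planar s t ->
    orbit t b = p ++ q -> p != [::] -> q != [::] ->
  exists t', [/\ planar s t', orbit t' b = p, fcycle t' q, ncycle t' = (ncycle t).+1 &
    forall z, ~~ fconnect t b z -> orbit t' z = orbit t z].
Proof.
move=> pl E /exists_rcons[p' [x Ep]] /exists_rcons[q' [y Eq]].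
have C := fcycle_orbit t b; have U := orbit_uniq t b.
rewrite E Ep Eq in C U; have [C1 C2 O] := orbit_split C U.
have cxy : fconnect t x y.
  by rewrite (fconnect_cycle C) mem_cat !mem_rcons !inE eqxx ?orbT.
exists (tperm x y * t)%g; split.
- by apply: planar_tperm => //; apply/or3P; apply: Or32.
- have Eb : rcons p' x = b :: behead (rcons p' x).
    by move: E; rewrite orbit_cons Ep Eq; case: (p') => [|? ?] /= [<-].
  move: U; rewrite cat_uniq Ep Eb => /and3P[U _ _].
  by apply: orbit_fcycle => //; rewrite -Eb.
- by rewrite Eq.
- apply: ncycle_tperm_split => //.
    apply/eqP => xy; move: U; rewrite cat_uniq => /and3P[_ /hasPn /(_ y)].
    by rewrite -xy !mem_rcons !mem_head => /(_ isT).
- by move=> z; rewrite fconnect_orbit E Ep Eq => /O.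
Qed.

(** The boundary segment labelled [r] is closed up by pinching and becomes an inner region; if this
    disconnects the map, the component of [b] is kept. *)
Lemma disk_relator n p r : p != [::] -> r != [::] -> P r -> disk n (p ++ r) -> disk n.+1 p.
Proof.
move=> p0 r0 Pr [T [s [t [lab [b [lS pl conn [fW fP] ct]]]]]].
have [p' [q' [E Ep Eq]]] := orbit_face fW.
have p0' : p' != [::] by apply: contra p0 => /eqP p0; rewrite -Ep p0.
have q0' : q' != [::] by apply: contra r0 => /eqP q0; rewrite -Eq q0.
have [t' [pl' O' C' ct' Ot]] := split_boundary pl E p0' q0'.
have U : uniq q' by have := orbit_uniq t b; rewrite E cat_uniq => /and3P[].
apply: (@disk_component _ _ _ s t' lab b) => //.
- by rewrite /face O'.
- move=> z _ nz; case: (boolP (z \in q')) => zq.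
    rewrite /face (orbitE C' U zq) map_rot Eq /rot; apply: Prot.
    by rewrite cat_take_drop.
  have bz : ~~ fconnect t b z.
    rewrite fconnect_orbit E mem_cat (negbTE zq) orbF.
    by rewrite fconnect_orbit O' in nz.
  by rewrite /face Ot //; apply: fP.
- by rewrite ct' !ltnS; apply: leq_trans ct _; apply: leq_addr.
Qed.

(* The boundary edges d1, d2 are glued to each other, and so are their opposites. *)
Lemma fold_edges (T : finType) (s t : {perm T}) (lab : T -> letter A) d1 d2 :
    labelled s lab -> planar s t -> t d1 = d2 -> t d2 = d1 -> d1 != d2 ->
    lab d2 = linv (lab d1) ->
  exists s', [/\ labelled s' lab, planar s' t & s' d1 = d2].
Proof.
move=> [sK sd ls] pl td1 td2 d12 l12.
have [sd1|sd12] := eqVneq (s d1) d2; first by exists s.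
set e1 := s d1 in sd12; set e2 := s d2.
have se1 : s e1 = d1 by rewrite sK.
have se2 : s e2 = d2 by rewrite sK.
have e12 : e1 != e2 by rewrite (inj_eq (@perm_inj _ s)).
have d1e1 : d1 != e1 by rewrite eq_sym sd.
have d2e2 : d2 != e2 by rewrite eq_sym sd.
have d1e2 : d1 != e2 by apply: contra sd12 => /eqP E; rewrite /e1 E se2.
have d2e1 : d2 != e1 by rewrite eq_sym.
(* The first transposition joins the two edges into the cycle [d1], [e1], [e2], [d2] of [s1], the
   second splits it into the pairs [d1], [d2] and [e1], [e2]. *)
pose s1 := (s * tperm e2 d1)%g; pose s' := (s1 * tperm e1 d2)%g.
have s'd1 : s' d1 = d2.
  by rewrite !permM -/e1 (tpermD (z := e1)) ?tpermL // eq_sym.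
have s'd2 : s' d2 = d1.
  by rewrite !permM -/e2 tpermL tpermD // eq_sym.
have s'e1 : s' e1 = e2.
  by rewrite !permM se1 tpermR tpermD.
have s'e2 : s' e2 = e1.
  by rewrite !permM se2 (tpermD (z := d2)) ?tpermR // eq_sym.
have s'D z : z != d1 -> z != d2 -> z != e1 -> z != e2 -> s' z = s z.
  move=> z1 z2 z3 z4; rewrite !permM.
  have h u v : z != u -> s u = v -> v != s z.
    by move=> zu <-; rewrite (inj_eq (@perm_inj _ s)) eq_sym.
  rewrite (tpermD (h _ _ z2 (erefl _)) (h _ _ z3 se1)).
  exact: tpermD (h _ _ z1 (erefl _)) (h _ _ z4 se2).
have cases z : [|| z == d1, z == d2, z == e1 | z == e2] \/
   [/\ z != d1, z != d2, z != e1 & z != e2].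
  case: eqVneq => //= _; first by left.
  case: eqVneq => //= _; first by left.
  case: eqVneq => //= _; first by left.
  by case: eqVneq => //= _; [left | right].
exists s'; split => //.
- split=> z; case: (cases z) => [/or4P[] /eqP->|[z1 z2 z3 z4]];
    rewrite ?s'd1 ?s'd2 ?s'e1 ?s'e2 //; try by rewrite eq_sym.
  + rewrite (s'D z) // s'D ?sK //.
    * by apply: contra z3 => /eqP E; rewrite /e1 -E sK.
    * by apply: contra z4 => /eqP E; rewrite /e2 -E sK.
    * by apply: contra z1 => /eqP E; rewrite -(inj_eq (@perm_inj _ s)) E.
    * by apply: contra z2 => /eqP E; rewrite -(inj_eq (@perm_inj _ s)) E.
  + by rewrite s'D.
  + by rewrite l12 linvK.
  + by rewrite !ls l12.
  + by rewrite !ls l12 linvK.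
  + by rewrite s'D.
(* The transposition that defines [s1] is allowed by a common vertex, the other one by the common
   cycle of [s1]. *)
- apply: planar_tperm_l.
    apply: planar_tperm_l => //; apply/or3P; apply: Or33.
    rewrite pfrel_sym td1.
    by have := fconnect1 (s * t)%g d2; rewrite permM.
  apply/or3P; apply: Or32.
  have h1 : s1 e1 = e2 by rewrite permM se1 tpermR.
  have h2 : s1 e2 = d2 by rewrite permM se2 tpermD // eq_sym.
  rewrite -h2 -h1; apply: connect_trans (fconnect1 _ _) (fconnect1 _ _).
Qed.

(** Pinching off the two last sides makes them a region of their own. Once glued to each other they
    form a component without [b]; dropping it removes the extra region, so the fold is free. *)
Lemma disk_fold n p x : p != [::] -> disk n (p ++ [:: x; linv x]) -> disk n p.
Proof.
move=> p0 [T [s [t [lab [b [lS pl conn [fW fP] ct]]]]]].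
have [p' [q' [E Ep Eq]]] := orbit_face fW.
case: q' Eq E => [|d1 [|d2 [|? ?]]] //= [l1 l2] E.
have p0' : p' != [::] by apply: contra p0 => /eqP p0; rewrite -Ep p0.
have [t' [pl' O' /and3P[/eqP td1 /eqP td2 _] ct' Ot]] := split_boundary pl E p0' isT.
have U := orbit_uniq t b; rewrite E cat_uniq /= !inE orbF negb_or andbT in U.
case/and3P: U => _ /andP[d1p d2p] d12.
have l12 : lab d2 = linv (lab d1) by rewrite l1 l2.
have [s' [lS' pl'' sd1]] := fold_edges lS pl' td1 td2 d12 l12.
have [sK' _ _] := lS'.
have cl : closed (hrel s' t') (pred2 d1 d2).
  apply: intro_closed (@hrel_sym _ s' t') _ _ => u v /orP[] /eqP <-;
  rewrite !inE => /orP[] /eqP->; rewrite ?td1 ?td2 ?sd1 ?eqxx ?orbT //.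
  by rewrite -sd1 sK' eqxx.
have nb : (b \in pred2 d1 d2) = false.
  have bp : b \in p' by rewrite -O' in_orbit.
  apply/negbTE; rewrite !inE negb_or.
  by apply/andP; split; [apply: contraNneq d1p | apply: contraNneq d2p] => <-.
apply: (@disk_component _ _ _ s' t' lab b) => //.
- by rewrite /face O'.
- move=> z bz nz.
  have bz' : ~~ fconnect t b z.
    rewrite fconnect_orbit E mem_cat -O' -fconnect_orbit (negbTE nz) /=.
    by have := closed_connect cl bz; rewrite nb !inE => <-.
  by rewrite /face Ot //; apply: fP.
- rewrite ct' -addn1; apply: leq_add ct _; apply/(fcard_gt0P (@perm_inj _ t')).
    apply: predC_closed => u v /eqP <-.
    by apply: (closed_connect (connect_closed (@hrel_sym _ s' t') b)); apply: hrel_r.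
  exists d1; change (~~ hconnect s' t' b d1).
  by apply/negP => /(closed_connect cl); rewrite nb !inE eqxx.
Qed.

(** A [disk] has a base dart, hence a nonempty label, which is why the empty word is set apart.
    Rotations bring the modified segment to the end of the boundary. *)
Lemma disk_of_area n w : area P n w -> w = [::] \/ disk n w.
Proof.
elim=> {n w} [|n u v x _ [uv|D]|n u v x _ [|D]|n u r v Pr _ [|D]|n w _ [|D]].
- by left.
- right; case: u v uv => // -[] // _; exact: disk_leq (disk_pair x).
- right; have := disk_pendant x (disk_rot D); rewrite -catA => /disk_rot.
  by rewrite -catA.
- by case: u => [|? ?].
- case: (altP (v ++ u =P [::])) => [|vu]; first by case: v {D} => //=; case: u => //; left.
  right; apply: disk_rot; apply: (@disk_fold _ _ x vu); rewrite -catA; apply: disk_rot.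
  by rewrite -catA.
- by move=> E; left; case: u E => //=; case: r Pr => //= _ ->.
- case: (altP (v ++ u =P [::])) => [|vu]; first by case: v {D} => //=; case: u => //; left.
  case: (altP (r =P [::])) => [r0|r0].
    by right; apply: (disk_leq (leqnSn n)); rewrite r0 in D.
  right; apply: disk_rot; apply: (disk_relator vu r0 Pr); rewrite -catA; apply: disk_rot.
  by rewrite -catA.
- by left.
- by right; apply: (disk_leq (leqnSn n)).
Qed.

End Disk.

(** * Combinatorial maps as pairs of permutations *)

Section MapPerms.
Variable G : combinatorial_map.
Local Notation T := (dart G).

Definition eperm : {perm T} := perm (inv_inj (@einvK G)).
Definition nperm : {perm T} := perm (@next_inj G).

Lemma epermE : eperm = @einv G :> (T -> T).
Proof. by apply/funext => x; rewrite permE. Qed.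

Lemma npermE : nperm = @next G :> (T -> T).
Proof. by apply/funext => x; rewrite permE. Qed.

Lemma turnE : (eperm * nperm)%g = @turn G :> (T -> T).
Proof. by apply/funext => x; rewrite permM epermE npermE. Qed.

Lemma epermK : involutive eperm.
Proof. by rewrite epermE; apply: einvK. Qed.

Lemma eperm_neq d : eperm d != d.
Proof. by rewrite epermE; apply: einv_neq. Qed.

Lemma map_connectedE : map_connected G <-> forall x y, hconnect eperm nperm x y.
Proof.
rewrite /map_connected.
have E x y : connect [rel u v : T | (v == einv u) || (v == next u)] x y = hconnect eperm nperm x y.
  by apply: eq_connect => u v; rewrite /hrel /= epermE npermE !(eq_sym v).
by split=> H x y; have := H x y; rewrite E.
Qed.

Lemma vertex_countE (b : T) : vertex_count G = ncycle (eperm * nperm)%g.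
Proof.
by rewrite /vertex_count /ncycle turnE eqn0Ngt (_ : 0 < #|T|) ?addn0 //; apply/card_gt0P; exists b.
Qed.

Lemma region_countE (b : T) : region_count G = ncycle nperm.
Proof.
by rewrite /region_count /ncycle npermE eqn0Ngt (_ : 0 < #|T|) ?addn0 //; apply/card_gt0P; exists b.
Qed.

Lemma edge_countE : edge_count G = ncycle eperm.
Proof.
by rewrite /edge_count (card_invol epermK eperm_neq) mul2n doubleK.
Qed.

Lemma sphericalE (b : T) : map_connected G -> (spherical G <-> planar eperm nperm).
Proof.
move/map_connectedE => conn; rewrite /spherical (vertex_countE b) (region_countE b) edge_countE.
rewrite /planar (ncomp_conn conn b) (card_invol epermK eperm_neq).
by split=> [H|/eqP H]; [apply/eqP|]; lia.
Qed.

Lemma followsE d e : follows d e = same_vertex eperm nperm (eperm d) e.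
Proof. by rewrite /follows /same_vertex turnE epermE. Qed.

Lemma path_follows d q x : path (@follows G) d (rcons q x) = vpath eperm nperm (eperm d) q x.
Proof. by elim: q d => [|e q IH] d /=; rewrite followsE ?andbT // IH. Qed.

Lemma closed_vpath x p : vpath eperm nperm x p x -> closed_path p.
Proof.
case: p => [|d q] //= /andP[xd dq]; rewrite /closed_path /= path_follows.
by rewrite -(vpath_svr _ _ xd).
Qed.

Lemma closed_pathE d q : closed_path (d :: q) = vpath eperm nperm d (d :: q) d.
Proof. by rewrite /closed_path /= path_follows sv_refl. Qed.

Lemma closed_orbit d : closed_path (orbit (@next G) d).
Proof. by rewrite -npermE; apply: closed_vpath (vpath_orbit nperm epermK d). Qed.

Lemma simply_connected_map (b : T) : planar eperm nperm ->
    (forall x y, hconnect eperm nperm x y) ->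
  simply_connected [set z | ~~ fconnect nperm b z].
Proof.
move=> pl conn [|d q] cp; first exact: rst_refl.
rewrite closed_pathE in cp.
have := map_simply_connected epermK b eperm_neq pl conn cp.
elim=> {q cp} [p q [xp xq H]|p|p q _ IH|p q r _ IH1 _ IH2].
- apply: rst_step; split; try exact: closed_vpath xp; try exact: closed_vpath xq.
  case: H => u [k [v [-> -> H]]]; exists u, k, v; split => //.
  case: H => -[e]; first by rewrite epermE => ->; left; exists e.
  by rewrite {2}npermE => be ->; right; exists e; rewrite ?inE.
- exact: rst_refl.
- exact: rst_sym.
- exact: rst_trans IH1 IH2.
Qed.

(* phi marks the edges crossed by a path in the dual graph from the region of x
   to that of y; each other region is entered as often as it is left. *)
Lemma dual_path x y : hconnect eperm nperm x y ->
  exists phi : pred T, (forall d, phi (eperm d) = phi d) /\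
    forall z, odd (count phi (orbit nperm z))
      = fconnect nperm z x (+) fconnect nperm z y.
Proof.
case/connectP => p; elim: p x => [|x' p IH] x /=.
  move=> _ ->; exists pred0; split => // z; by rewrite count_pred0 addbb.
move=> /andP[xx' pp] /(IH _ pp)[phi [ps pc]].
case/orP: xx' => /eqP E; last first.
  by exists phi; split => // z; rewrite pc -E -(same_fconnect1_r (@perm_inj _ nperm)).
pose psi := pred2 x (eperm x).
exists (fun d => phi d (+) psi d); split=> [d|z].
  rewrite ps /psi /=; congr (_ (+) _).
  by rewrite (inj_eq (@perm_inj _ eperm)) -{1}(epermK x) (inj_eq (@perm_inj _ eperm)) orbC.
have odd_count (f g : pred T) r : odd (count (fun d => f d (+) g d) r) = odd (count f r) (+) odd (count g r).
  elim: r => //= a r IHr; rewrite !oddD IHr; case: (f a); case: (g a) => /=;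
  by case: (odd (count f r)); case: (odd (count g r)).
have nex : eperm x != x by exact: eperm_neq.
rewrite odd_count pc -E.
have -> : odd (count psi (orbit nperm z)) = fconnect nperm z x (+) fconnect nperm z (eperm x).
  have -> : count psi (orbit nperm z) = count_mem x (orbit nperm z) + count_mem (eperm x) (orbit nperm z).
    rewrite -[LHS]addn0 -(count_predUI (pred1 x) (pred1 (eperm x))); congr (_ + _).
    symmetry; apply/eqP; rewrite -leqn0 leqNgt -has_count; apply/hasPn => d _ /=.
    by apply/negP => /andP[/eqP ->]; rewrite eq_sym (negbTE nex).
  by rewrite oddD !count_uniq_mem ?orbit_uniq // !oddb -!fconnect_orbit.
by case: (fconnect _ z x) (fconnect _ z y) (fconnect _ z (eperm x)) => [] [] [].
Qed.

(** The parity of crossings with a dual path from the region of [e] to that of [b] is invariant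
    under homotopy, since neither end lies in a 2-cell. The boundary of the region of [e] is
    contractible, yet it would have odd parity if the two regions were distinct. *)
Lemma simply_connected_outer (c : {set T}) b e : map_connected G ->
    fclosed (@next G) c -> simply_connected c -> b \notin c -> e \notin c ->
  fconnect nperm b e.
Proof.
move=> /map_connectedE conn cl sc nb ne.
have [phi [ps pc]] := dual_path (conn e b).
have inv p q : clos_refl_sym_trans _ (@homotopy_step G c) p q ->
    odd (count phi p) = odd (count phi q).
  elim=> {p q} [p q [_ _ [u [k [v [-> -> H]]]]]|p|p q _ ->|p q r _ -> _ ->] //.
  rewrite !count_cat !oddD; suff -> : odd (count phi k) = false by rewrite addFb.
  case: H => [[d ->]|[d dc ->]]; first by rewrite /= -epermE ps addn0 oddD addbb.
  have nc z : z \notin c -> fconnect nperm d z = false.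
    rewrite npermE => zc; apply/negbTE; apply: contra zc => dz.
    by rewrite -(closed_connect cl dz).
  by rewrite -npermE pc !nc.
have := inv _ _ (sc _ (closed_orbit e)).
by rewrite -npermE pc connect0 /= => /negbFE; rewrite pfrel_sym.
Qed.

End MapPerms.

Lemma cyclic_eq_cat (T : Type) (p q r : seq T) : cyclic_eq (p ++ q) r -> cyclic_eq (q ++ p) r.
Proof.
case=> i E; have H : forall s : seq T, cyclic_eq s r -> cyclic_eq (rot 1 s) r.
  move=> s [j ->]; have [jr|rj] := ltnP j (size r).
    by exists j.+1; rewrite -rotD add1n.
  by exists 1; rewrite (rot_oversize rj).
have {}H k (s : seq T) : cyclic_eq s r -> cyclic_eq (iter k (rot 1) s) r.
  by move=> Hs; elim: k => //= k IH; apply: H.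
suff -> : q ++ p = iter (size p) (rot 1) (p ++ q) by apply: H; exists i.
elim: p q {E} => [|x p IH] q; first by rewrite cats0.
by rewrite -cat_rcons IH /= -iterS iterSr -rcons_cat rot1_cons.
Qed.

(** * Passage between diagrams, disks and areas *)

Section Diagrams.
Variables (A : finType) (R : seq (word A)).

Definition relator (w : word A) : Prop :=
  exists2 r, r \in R & cyclic_eq w r \/ cyclic_eq w (winv r).

Lemma relator_rot p q : relator (p ++ q) -> relator (q ++ p).
Proof.
by case=> r rR H; exists r => //; case: H => /cyclic_eq_cat; [left | right].
Qed.

Section OfPerms.
Variables (T : finType) (s t : {perm T}).
Hypotheses (sK : involutive s) (sd : forall d, s d != d).

Definition perm_map : combinatorial_map :=
  @CombinatorialMap T s t sK sd (@perm_inj _ t).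

Lemma eperm_map : eperm perm_map = s.
Proof. by apply/perm.permP => x; rewrite permE. Qed.

Lemma nperm_map : nperm perm_map = t.
Proof. by apply/perm.permP => x; rewrite permE. Qed.
End OfPerms.

Lemma diagram_of_disk n W : disk relator n W ->
  exists D : diagram R, boundary_label D = W /\ cell_count 2 D <= n.
Proof.
move=> [T [s [t [lab [b [[sK sd ls] pl conn [fW fP] ct]]]]]].
pose G := perm_map t sK sd.
have conn' : map_connected G by apply/map_connectedE; rewrite eperm_map nperm_map.
have sph : spherical G by apply/(@sphericalE G b conn'); rewrite eperm_map nperm_map.
pose c := [set z : dart G | ~~ fconnect t b z].
have clo : fclosed (@next G) c.
  move=> x y /eqP <-; rewrite !inE /=.
  by rewrite -(same_fconnect1_r (@perm_inj _ t)).
have cyc : ufcycle (@next G) (orbit t b).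
  by rewrite /ucycle fcycle_orbit orbit_uniq.
have nil : orbit t b = [::] -> #|dart G| = 0 by rewrite orbit_cons.
have out (e : dart G) : e \in orbit t b -> e \notin c.
  by rewrite inE negbK fconnect_orbit.
have sc : simply_connected c.
  have := @simply_connected_map G b; rewrite eperm_map nperm_map; exact.
have le (e : dart G) : lab (einv e) = linv (lab e) by exact: ls.
have lt (e : dart G) : e \in c -> exists2 r : word A, r \in R &
    cyclic_eq (map lab (orbit (@next G) e)) r \/
    cyclic_eq (map lab (orbit (@next G) e)) (winv r).
  by rewrite inE => /fP.
exists (@Diagram A R G c (orbit t b) lab conn' sph clo cyc nil out sc le lt).
split=> //; rewrite /cell_count /=.
(* The outer region makes the difference between [n.+1] regions and [n] 2-cells. *)
move: ct; rewrite /ncycle (n_compC [pred z | z \notin c]).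
have -> : fcard t [pred z | z \notin c] = 1.
  rewrite -(n_comp_connect (@pfrel_sym _ t) b); apply: eq_n_comp_r => z.
  by rewrite !inE negbK.
rewrite add1n ltnS; congr (_ <= _); apply: eq_n_comp_r => z.
by rewrite !inE negbK.
Qed.

Definition void_map : combinatorial_map :=
  @CombinatorialMap void id id (fun x => match x with end)
    (fun x => match x with end) (fun x => match x with end).

Lemma empty_diagram : exists D : diagram R, boundary_label D = [::] /\ cell_count 2 D = 0.
Proof.
have c0 : #|{: void}| = 0 by apply: eq_card0; case.
have conn : map_connected void_map by case.
have sph : spherical void_map.
  rewrite /spherical /vertex_count /region_count /edge_count c0 /=.
  have E (f : void -> void) : fcard f {: void} = 0 by apply: eq_card0; case.
  by rewrite !E.
have sc : @simply_connected void_map set0 by case=> [|[]] _; apply: rst_refl.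
have clo : fclosed (@next void_map) (set0 : {set dart void_map}) by case.
have nil : [::] = [::] :> seq void -> #|dart void_map| = 0 by [].
have out (e : dart void_map) : e \in [::] -> e \notin (set0 : {set dart void_map}) by [].
exists (@Diagram A R void_map set0 [::] (fun x : void => match x with end) conn sph clo
  (erefl true) nil out sc (fun x : void => match x with end) (fun x : void => match x with end)).
by split=> //; apply: eq_card0; case.
Qed.

Lemma diagram_of_area n W : area relator n W ->
  exists D : diagram R, boundary_label D = W /\ cell_count 2 D <= n.
Proof.
case/(disk_of_area relator_rot) => [->|]; last exact: diagram_of_disk.
by have [D [E1 E2]] := empty_diagram; exists D; rewrite E2.
Qed.

Section OfDiagram.
Variable D : diagram R.
Local Notation s := (eperm D).
Local Notation t := (nperm D).

Lemma diagram_conn x y : hconnect s t x y.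
Proof. by move: x y; apply/map_connectedE; apply: skeleton_connected. Qed.

Lemma diagram_planar : dart D -> planar s t.
Proof. by move=> b; apply/(sphericalE b (@skeleton_connected _ _ D))/skeleton_spherical. Qed.

Lemma diagram_bnd b q : bnd D = b :: q -> orbit t b = b :: q.
Proof.
move=> E; have := bnd_cycle D; rewrite E /ucycle -npermE => /andP[].
exact: orbit_fcycle.
Qed.

Lemma diagram_twocell b q z : bnd D = b :: q -> ~~ fconnect t b z = (z \in twocell D).
Proof.
move=> E; have nb : b \notin twocell D by apply: bnd_outer; rewrite E mem_head.
case: (boolP (z \in twocell D)) => zc.
  apply/negP => bz; case/negP: nb; rewrite npermE in bz.
  by rewrite (closed_connect (@twocell_closed _ _ D) bz).
apply/negbTE; rewrite negbK.
exact: simply_connected_outer (@skeleton_connected _ _ D) (@twocell_closed _ _ D)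
  (@diagram_simply_connected _ _ D) nb zc.
Qed.

Lemma diagram_empty : bnd D = [::] ->
  [/\ vertex_count D = 1, edge_count D = 0 & cell_count 2 D = 0].
Proof.
move/bnd_nil => E.
have N (x : dart D) : False by have := card0_eq E x.
rewrite /vertex_count /edge_count /cell_count E; split => //.
  by rewrite (_ : fcard _ _ = 0) //; apply: eq_card0 => x; case: (N x).
by apply: eq_card0 => x; case: (N x).
Qed.

Lemma diagram_cells b q : bnd D = b :: q ->
  [/\ vertex_count D = ncycle (s * t)%g, edge_count D = ncycle s,
      cell_count 2 D = (ncycle t).-1 & 0 < ncycle t].
Proof.
move=> E; rewrite (vertex_countE b) edge_countE; split => //; last exact: ncycle_gt0 b.
rewrite /ncycle (n_compC (fconnect t b)) (n_comp_connect (@pfrel_sym _ t) b) add1n /=.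
rewrite -npermE; apply: eq_n_comp_r => z.
by rewrite -(diagram_twocell z E) !inE.
Qed.

Lemma diagram_euler : vertex_count D + cell_count 2 D = (edge_count D).+1.
Proof.
case E : (bnd D) => [|b q]; first by have [-> -> ->] := diagram_empty E.
have [-> -> -> Ft] := diagram_cells E.
have := euler (@epermK D) (@eperm_neq D) (diagram_planar b) diagram_conn b.
by lia.
Qed.

Lemma diagram_vertices : 0 < vertex_count D.
Proof.
case E : (bnd D) => [|b q]; first by have [-> _ _] := diagram_empty E.
by have [-> _ _ _] := diagram_cells E; apply: ncycle_gt0 b.
Qed.

Variable M : nat.
Hypothesis RM : forall r, r \in R -> size r <= M.

Lemma relator_size w : relator w -> size w <= M.
Proof.
by case=> r /RM rM [] [i ->]; rewrite size_rot ?size_winv.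
Qed.

Lemma diagram_face b q z : bnd D = b :: q -> ~~ fconnect t b z ->
  relator (face (@lab A R D) t z).
Proof.
move=> E; rewrite (diagram_twocell z E) => /lab_twocell [r rR H].
by exists r; rewrite // /face npermE.
Qed.

Lemma diagram_edges : 2 * edge_count D <= M * cell_count 2 D + size (bnd D).
Proof.
case E : (bnd D) => [|b q]; first by have [_ -> _] := diagram_empty E.
have [_ -> -> _] := diagram_cells E.
rewrite -(card_invol (@epermK D) (@eperm_neq D)) -(cardC (fconnect t b)) addnC.
apply: leq_add; last by rewrite -(diagram_bnd E) size_orbit.
have cl : fclosed t [predC (fconnect t b)].
  by apply: predC_closed; apply: connect_closed; apply: pfrel_sym.
rewrite (card_closed cl) /ncycle (n_compC (fconnect t b)) (n_comp_connect (@pfrel_sym _ t) b) add1n /=.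
rewrite /n_comp_mem mulnC -sum_nat_const.
apply: leq_sum => r /andP[_ br].
rewrite -size_orbit -(size_map (@lab A R D)); apply: relator_size.
by apply: diagram_face E _.
Qed.

Variable K : nat.
Hypothesis KP : forall w : word A, size w <= M ->
  (exists m, area relator m (winv w)) -> area relator K (winv w).

Lemma diagram_area :
  area relator (3 * (vertex_count D + size (bnd D)) * K) (boundary_label D).
Proof.
rewrite /boundary_label; case E : (bnd D) => [|b q].
  exact: area_leq (leq0n _) (AreaNil _).
have [-> _ _ _] := diagram_cells E.
rewrite -(diagram_bnd E) size_orbit.
apply: (area_of_vertices KP (@epermK D) (@eperm_neq D)).
- by move=> d; rewrite epermE lab_einv.
- exact: diagram_planar.
- exact: diagram_conn.
- move=> z bz; have Pz := diagram_face E bz; split.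
    by have := relator_size Pz; rewrite size_map size_orbit.
  by exists 1; apply: area_relator.
Qed.

End OfDiagram.
End Diagrams.

(** * Dehn functions *)

(** The origin of [K]: excluded middle decides for each element whether some bound exists, and a
    maximum is taken over the finite list. *)
Lemma uniform_bound (T : eqType) (Q : T -> nat -> Prop) (l : seq T) :
    (forall x n m, n <= m -> Q x n -> Q x m) ->
  exists K, forall x, x \in l -> (exists n, Q x n) -> Q x K.
Proof.
move=> mono; elim: l => [|x l [K HK]]; first by exists 0.
have [[n Qn]|nQ] := pselect (exists n, Q x n).
  exists (maxn n K) => y; rewrite inE => /orP[/eqP -> _|yl ey].
    by apply: mono Qn; apply: leq_maxl.
  by apply: mono (HK y yl ey); apply: leq_maxr.
by exists K => y; rewrite inE => /orP[/eqP -> //|]; apply: HK.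
Qed.

Definition words (T : finType) M : seq (seq T) :=
  flatten [seq [seq val w | w <- enum {: n.-tuple T}] | n <- iota 0 M.+1].

Lemma mem_words (T : finType) M (w : seq T) : size w <= M -> w \in words T M.
Proof.
move=> wM; apply/flattenP.
exists [seq val v | v <- enum {: (size w).-tuple T}].
  by apply/mapP; exists (size w); rewrite // mem_iota.
by apply/mapP; exists (in_tuple w); rewrite // mem_enum.
Qed.

Section MinCells.
Variables (A : finType) (R : seq (word A)).
Implicit Types W : word A.

Lemma min_cellsP j W : (exists D : diagram R, cyclic_eq (boundary_label D) W) ->
  is_min_cells R j W (min_cells R j W).
Proof.
move=> [D0 D0W]; apply: xgetPex.
pose Q n := `[< exists D : diagram R, cyclic_eq (boundary_label D) W /\ cell_count j D = n >].
have exQ : exists n, Q n by exists (cell_count j D0); apply/asboolP; exists D0.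
case: (ex_minnP exQ) => n /asboolP Qn minn; exists n; split=> // D DW.
by apply: minn; apply/asboolP; exists D.
Qed.

Lemma min_cells_none j W : ~ (exists D : diagram R, cyclic_eq (boundary_label D) W) ->
  min_cells R j W = 0.
Proof.
by move=> nD; apply: xgetPN => n [[D [DW _]] _]; apply: nD; exists D.
Qed.

(** [D'] may differ from [D], as is needed for bounds in terms of vertices; equal boundary labels
    suffice to compare the minima. *)
Definition cells_bounded i j C := forall D : diagram R, exists D' : diagram R,
  boundary_label D' = boundary_label D /\
  cell_count i D' <= C * cell_count j D + C * size (bnd D) + C.

Lemma min_cells_bounded i j C W : cells_bounded i j C ->
  min_cells R i W <= C * min_cells R j W + C * size W + C.
Proof.
move=> H; have [eD|nD] := pselect (exists D : diagram R, cyclic_eq (boundary_label D) W).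
  have [[D [DW <-]] _] := min_cellsP j eD; have [_ mini] := min_cellsP i eD.
  have [D' [E HD']] := H D; rewrite -E in DW.
  have := mini D' DW; case: (DW) => k; rewrite E => /(congr1 size).
  by rewrite size_rot size_map => <- le; apply: leq_trans le HD'.
by rewrite !min_cells_none.
Qed.

Lemma dehn_mono j x y : x <= y -> dehn R j x <= dehn R j y.
Proof.
move=> xy; apply/bigmax_leqP => n _.
have ny : n < y.+1 by apply: leq_trans (ltn_ord n) _.
exact: (bigmax_sup (Ordinal ny)).
Qed.

Lemma fpreceq_dehn i j C : cells_bounded i j C -> fpreceq (dehn R i) (dehn R j).
Proof.
(* As [0 < x], the additive [C] is at most [C * x], which doubles the linear term; the successor
   keeps the constant positive when [C] is 0. *)
move=> H; exists (2 * C).+1; split=> // x x0.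
apply: (@leq_trans (C * dehn R j x + C * x + C)); last first.
  have := @dehn_mono j x ((2 * C).+1 * x) (leq_pmull _ _) => /(_ isT) h.
  apply: (@leq_trans (C * dehn R j ((2 * C).+1 * x) + C * x + C)).
    by rewrite !leq_add2r leq_mul2l h orbT.
  have Cx : C <= C * x by rewrite leq_pmulr.
  rewrite -addnA leq_add //; first by rewrite leq_mul2r; apply/orP; right; lia.
  rewrite mulSn -mulnA mul2n -addnn; lia.
apply/bigmax_leqP => n _; apply/bigmax_leqP => W ncW.
have nx : n <= x by rewrite -ltnS.
apply: leq_trans (min_cells_bounded W H) _; rewrite size_tuple.
rewrite leq_add2r; apply: leq_add; rewrite leq_mul2l; apply/orP; right => //.
apply: (bigmax_sup n) => //; exact: (bigmax_sup W).
Qed.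

End MinCells.

Theorem theorem1p7 (A : finType) (R : seq (word A))
    (HR : finite_presentation R) :
  [/\ fequiv (dehn R 0) (dehn R 1),
      fequiv (dehn R 1) (dehn R 2) &
      fequiv (dehn R 0) (dehn R 2)].
Proof.
pose M := \max_(r <- R) size r.
have RM r : r \in R -> size r <= M by move=> rR; apply: leq_bigmax_seq.
have [K KP] := uniform_bound (words (letter A) M)
  (fun w n m nm => @area_leq A (relator R) n m (winv w) nm).
have {}KP w : size w <= M -> (exists m, area (relator R) m (winv w)) ->
    area (relator R) K (winv w).
  by move=> /mem_words; apply: KP.
have small (D : diagram R) : exists D' : diagram R, boundary_label D' = boundary_label D /\
    cell_count 2 D' <= 3 * (vertex_count D + size (bnd D)) * K.
  exact: diagram_of_area (diagram_area D RM KP).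
have eqbnd (D D' : diagram R) : boundary_label D' = boundary_label D ->
    size (bnd D') = size (bnd D).
  by move=> /(congr1 size); rewrite !size_map.
have b01 : cells_bounded R 0 1 1.
  by move=> D; exists D; split=> //=; have := diagram_euler D; lia.
have b21 : cells_bounded R 2 1 1.
  by move=> D; exists D; split=> //; have := diagram_euler D;
    have := diagram_vertices D; rewrite /cell_count; lia.
have b12 : cells_bounded R 1 2 M.+1.
  move=> D; exists D; split=> //; have := diagram_edges D RM.
  by rewrite [cell_count 1 D]/=; move: (cell_count 2 D) => f; lia.
have b02 : cells_bounded R 0 2 M.+1.
  move=> D; exists D; split=> //; have := diagram_edges D RM.
  have := diagram_euler D; rewrite [cell_count 0 D]/=; move: (cell_count 2 D) => f; lia.
have b20 : cells_bounded R 2 0 (3 * K).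
  move=> D; have [D' [E H]] := small D; exists D'; split=> //.
  rewrite [cell_count 0 D]/=; apply: leq_trans H _; rewrite mulnAC mulnDr; exact: leq_addr.
(* The edges of the new diagram are bounded through its 2-cells: [3 * K * M] comes from substituting
   the bound of [small] into [diagram_edges], and 1 from the boundary length there. *)
have b10 : cells_bounded R 1 0 (3 * K * M + 1).
  move=> D; have [D' [E H]] := small D; exists D'; split=> //.
  have := diagram_edges D' RM; rewrite (eqbnd _ _ E).
  rewrite [cell_count 0 D]/= [cell_count 1 D']/=.
  have := leq_mul (leqnn M) H.
  move: (cell_count 2 D') (edge_count D') (vertex_count D) (size (bnd D)) => f e v w.
  rewrite mulnAC mulnDr mulnDr !mulnA => H1 H2.
  have E1 : M * 3 * K = 3 * K * M by rewrite -mulnA mulnC.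
  rewrite E1 in H1; rewrite !mulnDl !mul1n; lia.
split; split; exact: fpreceq_dehn.
Qed.
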